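(* Let $\mathcal H_{\rm word}$ be the class of word-representable graphs. Then for every $p\in[0,1]$, $$\mathrm{ed}_{\mathcal H_{\rm word}}(p)=\min\{p/3,\;1-p\}.$$ Consequently $\max\{\mathrm{dist}(G,\mathcal H_{\rm word}) : |V(G)|=n\}=\tfrac14-o(1)$ as $n\to\infty$ (equivalently, the maximum over $n$-vertex graphs $G$ of the minimum number of edge additions/deletions needed to make $G$ word-representable is $\tfrac14\binom n2-o(n^2)$). Moreover, for every $\epsilon>0$ and every graph $G$ on $n\ge 2$ vertices, if $\mathrm{dist}(G,\mathcal H_{\rm word})\ge \tfrac14-\epsilon$, then $|E(G)|/\binom n2\in[\tfrac34-3\epsilon,\tfrac34+\epsilon]$.
   Context: A word over an alphabet $V$ represents a graph $G=(V,E)$ if for all distinct $x,y\in V$: $xy\in E$ if and only if the occurrences of $x$ and $y$ alternate in the word. $G$ is word-representable if some word represents it; $\mathcal H_{\rm word}$ denotes the class of word-representable graphs (a hereditary property: closed under isomorphism and taking induced subgraphs). For graphs $G,H$ on the same $n$-vertex set, $\mathrm{dist}(G,H)=|E(G)\triangle E(H)|/\binom n2$. For a hereditary property $\mathcal H$, $\mathrm{dist}(G,\mathcal H)=\min\{\mathrm{dist}(G,H): H\in\mathcal H,\ V(H)=V(G)\}$. The edit distance function is $\mathrm{ed}_{\mathcal H}(p)=\lim_{n\to\infty}\max\{\mathrm{dist}(G,\mathcal H): |V(G)|=n,\ |E(G)|=\lfloor p\binom n2\rfloor\}$ (this limit exists for every hereditary property). *)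

(* Defs.v *)
From HB Require Import structures.
From mathcomp Require Import all_boot all_order all_algebra.
From mathcomp Require Import all_classical all_reals all_analysis.
Set Implicit Arguments. Unset Strict Implicit. Unset Printing Implicit Defensive.
Import Order.TTheory GRing.Theory Num.Theory.
Local Open Scope ring_scope.

Definition is_graph (n : nat) (E : {set {set 'I_n}}) : bool :=
  [forall e in E, #|e| == 2%N].

(* x and y alternate in w: deleting all other letters gives xyxy... or yxyx...
   i.e. consecutive letters of the restricted word are distinct. *)
Definition alternate (n : nat) (w : seq 'I_n) (x y : 'I_n) : bool :=
  sorted (fun a b => a != b) [seq z <- w | (z == x) || (z == y)].

Definition represents (n : nat) (w : seq 'I_n) (E : {set {set 'I_n}}) : Prop :=
  (forall x : 'I_n, x \in w) /\
  (forall x y : 'I_n, x != y -> ([set x; y] \in E <-> alternate w x y)).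

Definition word_representable (n : nat) (E : {set {set 'I_n}}) : Prop :=
  is_graph E /\ exists w : seq 'I_n, represents w E.

Definition gdist (R : realType) (n : nat) (E F : {set {set 'I_n}}) : R :=
  (#|(E :\: F) :|: (F :\: E)|)%:R / ('C(n, 2))%:R.

Definition dist_word (R : realType) (n : nat) (E : {set {set 'I_n}}) : R :=
  inf [set d : R | exists F : {set {set 'I_n}}, word_representable F /\ d = gdist R E F]%classic.

Definition max_dist_edges (R : realType) (n m : nat) : R :=
  sup [set d : R | exists E : {set {set 'I_n}},
         [/\ is_graph E, #|E| = m & d = dist_word R E]]%classic.

Definition max_dist (R : realType) (n : nat) : R :=
  sup [set d : R | exists E : {set {set 'I_n}}, is_graph E /\ d = dist_word R E]%classic.

(* Main.v *)
Require Import Defs.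
From HB Require Import structures.
From mathcomp Require Import all_boot all_order all_algebra.
From mathcomp Require Import ring lra zify.
From mathcomp Require Import boolp reals.
Set Implicit Arguments. Unset Strict Implicit. Unset Printing Implicit Defensive.
Import Order.TTheory GRing.Theory Num.Theory.

(** Upper bound: complete graphs and 3-colourable graphs are word-representable, and deleting the
monochromatic edges of a suitable 3-colouring removes at most a third of the edges.

Lower bound: order the vertices of a word-representable graph F by first occurrence in the word.
An edge x -> y means that in every prefix x occurs as often as y or once more, so if ab, bc, cd, ad
are edges with a < b < c < d, then ac and bd are edges too. Let G be a quasirandom graph of density
p and cut the order into k intervals. Inside these pick large subsets W_i such that every pair
(W_i, W_j) is either almost empty in F (white), almost complete (black), or densely has both edges
and non-edges on all large subsets (gray), while the density of the symmetric difference of F and G on the W_i is at most that on the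
intervals, up to a small error; the latter holds once the W_i live inside an almost optimal
cylinder. Counting gives the rule: if ab, bc, cd, ad are not white, then ac and bd are black.
Removing maximal cliques of non-white pairs one after the other shows
#gray <= 2 #white + O(k), and as white, black and gray pairs cost p, 1 - p and 0, the total cost is
at least min(p/3, 1 - p) of all pairs. *)

(** * Words *)

Section Prefix.
Variable T : eqType.
Implicit Types (w : seq T) (x y : T).

Definition leads w x y :=
  forall t, (count_mem y (take t w) <= count_mem x (take t w) <= (count_mem y (take t w)).+1)%N.

(** Starting the path at y forces the restricted word to begin with x. Once an x is read the two
    letters exchange roles, so the induction generalises over both. *)
Lemma path_leads w x y : x != y ->
  path (fun a b => a != b) y [seq z <- w | (z == x) || (z == y)] <-> leads w x y.
Proof.
elim: w x y => [|z w IH] x y xy /=; first by split => // _ t; rewrite /= .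
case: (eqVneq z x) => [->|zx] /=.
  rewrite eq_sym xy /=.
  have yx : y != x by rewrite eq_sym.
  have := IH y x yx; under eq_filter do rewrite orbC.
  move=> ->; split => h t; first (case: t => [|t] //=).
    by have := h t; rewrite eqxx (negbTE xy) /=; lia.
  by have := h t.+1; rewrite /= eqxx (negbTE xy) /=; lia.
case: (eqVneq z y) => [->|zy] /=.
  rewrite eqxx; split => // h.
  by have := h 1%N; rewrite /= take0 /= eqxx eq_sym (negbTE xy).
rewrite (IH x y xy); split => h t; first (case: t => [|t] //=).
  by have := h t; rewrite (negbTE zx) (negbTE zy).
by have := h t.+1; rewrite /= (negbTE zx) (negbTE zy).
Qed.

Lemma sorted_leads w x y : x != y -> y \in w -> (index x w < index y w)%N ->
  sorted (fun a b => a != b) [seq z <- w | (z == x) || (z == y)] <-> leads w x y.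
Proof.
move=> xy; rewrite -path_leads//.
elim: w => //= z w IH; rewrite inE eq_sym.
case: (eqVneq z x) => [->|zx] /=.
  by rewrite (negbTE xy) /= eq_sym xy.
by case: (eqVneq z y) => //= zy yw; rewrite ltnS => /(IH yw).
Qed.

(** In every prefix the counts satisfy a >= b >= c >= d >= a - 1, hence also c <= a <= c + 1 and d
    <= b <= d + 1. *)
Lemma leads_diag w a b c d :
  leads w a b -> leads w b c -> leads w c d -> leads w a d -> leads w a c /\ leads w b d.
Proof.
move=> ab bc cd ad; split=> t;
  move: (ab t) (bc t) (cd t) (ad t); lia.
Qed.
End Prefix.

(** * Three-colourable graphs *)

Section ThreeColour.
Variables (n : nat) (E : {set {set 'I_n}}) (col : 'I_n -> 'I_3).
Hypothesis Egraph : is_graph E.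
Hypothesis proper : forall x y, x != y -> [set x; y] \in E -> col x != col y.

Definition cls (i : nat) : seq 'I_n := [seq z <- enum 'I_n | val (col z) == i].

Definition word3 := cls 0 ++ cls 1 ++ cls 2.
Definition rword3 := rev (cls 0) ++ rev (cls 1) ++ rev (cls 2).

(* Two consecutive copies of [word3], except that at a boundary between consecutive colour
   classes the last u and the first v are exchanged. *)
Definition swap_at (u v : 'I_n) (i j : nat) :=
  [seq z <- cls i | z != u] ++ [:: v; u] ++ [seq z <- cls j | z != v].

(** The boundary from class 2 back to class 0 occurs only between two copies of [word3], so a block
    has two of them. *)
Definition block (u v : 'I_n) : seq 'I_n :=
  match val (col u) with
  | 0 => swap_at u v 0 1 ++ cls 2 ++ word3
  | 1 => cls 0 ++ swap_at u v 1 2 ++ word3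
  | _ => cls 0 ++ cls 1 ++ swap_at u v 2 0 ++ cls 1 ++ cls 2
  end.

Definition next_col (u v : 'I_n) : bool := val (col v) == (val (col u)).+1 %% 3.

(** The part [word3 ++ rword3] breaks the alternation of all pairs inside a colour class. Each block
    breaks one non-edge between classes and reads xyxy on every other pair with col x < col y. Two
    distinct colours are cyclically consecutive in exactly one order, so every such non-edge has a
    block. *)
Definition word : seq 'I_n :=
  (word3 ++ rword3) ++
  flatten [seq block uv.1 uv.2 | uv <- [seq (u, v) | u <- enum 'I_n, v <- enum 'I_n] &
             next_col uv.1 uv.2 && ([set uv.1; uv.2] \notin E)].

Lemma filter_uniq1 (s : seq 'I_n) (a : pred 'I_n) x : uniq s -> 
  (forall z, z \in s -> a z = (z == x)) -> [seq z <- s | a z] = if x \in s then [:: x] else [::].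
Proof.
move=> us h; rewrite (eq_in_filter h).
case: ifP => xs; first exact: filter_pred1_uniq.
by apply/eqP; rewrite -size_eq0 size_filter; apply/eqP/count_memPn; rewrite xs.
Qed.

Lemma cls_uniq i : uniq (cls i).
Proof. by rewrite filter_uniq ?enum_uniq. Qed.

Lemma mem_cls i z : (z \in cls i) = (val (col z) == i).
Proof. by rewrite mem_filter mem_enum andbT. Qed.

Definition one (x : 'I_n) i : seq 'I_n := if val (col x) == i then [:: x] else [::].

Lemma filter_cls x y i : col x != col y ->
  [seq z <- cls i | (z == x) || (z == y)] = one x i ++ one y i.
Proof.
move=> xy; have xy' : val (col x) != val (col y) by [].
rewrite /one; case: eqVneq => [ex|ex].
  rewrite (filter_uniq1 (x := x)) ?cls_uniq// ?mem_cls ?ex ?eqxx//.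
    by rewrite -ex eq_sym (negbTE xy').
  move=> z; rewrite mem_cls; case: (eqVneq z y) => [->|_]; last by rewrite orbF.
  by rewrite -ex eq_sym (negbTE xy').
rewrite (filter_uniq1 (x := y)) ?cls_uniq// ?mem_cls//.
by move=> z; rewrite mem_cls; case: (eqVneq z x) => [->|_]//=; rewrite (negbTE ex).
Qed.

Lemma filter_rcls x y i : col x != col y ->
  [seq z <- rev (cls i) | (z == x) || (z == y)] = one x i ++ one y i.
Proof.
move=> xy; rewrite filter_rev filter_cls// rev_cat /one.
have : val (col x) != val (col y) by [].
by case: (eqVneq (val (col x)) i) => [->|_]; case: (eqVneq (val (col y)) i).
Qed.

(** A pair of distinct colours other than {u, v} has at most one letter in each class and misses u
    or v, so it does not see the exchange. *)
Lemma filter_swap u v x y i j : i != j -> x != y -> col x != col y ->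
  val (col u) = i -> val (col v) = j -> [set x; y] != [set u; v] ->
  [seq z <- swap_at u v i j | (z == x) || (z == y)] =
  (one x i ++ one y i) ++ (one x j ++ one y j).
Proof.
move=> ij xy cxy ui vj uvxy; rewrite /swap_at !filter_cat.
have fC (w : 'I_n) k : [seq z <- [seq z <- cls k | z != w] | (z == x) || (z == y)] =
    [seq z <- one x k ++ one y k | z != w].
  rewrite -filter_cls// -[LHS]filter_predI -[RHS]filter_predI; by apply: eq_filter => z /=; rewrite andbC.
rewrite !fC /= !filter_cat /one; have {}cxy : val (col x) != val (col y) by [].
have ji : j != i by rewrite eq_sym.
have vu : v != u by apply: contraNneq ij => e; rewrite -ui -vj e.
have uv : u != v by rewrite eq_sym.
case: (eqVneq u x) => [ux|ux].
  subst x; have vy : v != y by apply: contraNneq uvxy => ->.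
  have yi : (val (col y) == i) = false by rewrite -ui eq_sym (negbTE cxy).
  have yv : y != v by rewrite eq_sym.
  rewrite ui yi eqxx (negbTE ij) /= eqxx (negbTE vu) (negbTE vy) /=.
  by case: ifP => //= _; rewrite yv.
case: (eqVneq u y) => [uy|uy].
  subst y; have vx : v != x by apply: contraNneq uvxy => ->; rewrite setUC.
  have xi : (val (col x) == i) = false by rewrite -ui (negbTE cxy).
  have xv : x != v by rewrite eq_sym.
  rewrite ui xi eqxx (negbTE ij) /= eqxx (negbTE vu) (negbTE vx) /=.
  by case: ifP => //= _; rewrite ?xv.
have xu : x != u by rewrite eq_sym.
have yu : y != u by rewrite eq_sym.
have fi : [seq z <- if val (col x) == i then [:: x] else [::] | z != u] =
  if val (col x) == i then [:: x] else [::] by case: ifP => //= _; rewrite xu.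
have fi' : [seq z <- if val (col y) == i then [:: y] else [::] | z != u] =
  if val (col y) == i then [:: y] else [::] by case: ifP => //= _; rewrite yu.
rewrite fi fi' /=.
case: (eqVneq v x) => [vx|vx].
  have xi : (val (col x) == i) = false by rewrite -vx vj (negbTE ji).
  have yj : (val (col y) == j) = false by rewrite -vj vx eq_sym (negbTE cxy).
  by subst v; rewrite xi yj vj eqxx /= ?eqxx /= ?cats0; case: ifP.
case: (eqVneq v y) => [vy|vy].
  have yi : (val (col y) == i) = false by rewrite -vy vj (negbTE ji).
  have xj : (val (col x) == j) = false by rewrite -vj vy (negbTE cxy).
  by subst v; rewrite yi xj vj eqxx /= ?eqxx /= ?cats0; case: ifP.
have xv : x != v by rewrite eq_sym.
have yv : y != v by rewrite eq_sym.
have -> : [seq z <- if val (col x) == j then [:: x] else [::] | z != v] =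
  if val (col x) == j then [:: x] else [::] by case: ifP => //= _; rewrite xv.
by have -> : [seq z <- if val (col y) == j then [:: y] else [::] | z != v] =
  if val (col y) == j then [:: y] else [::] by case: ifP => //= _; rewrite yv.
Qed.

Lemma filter_word3 x y : col x != col y ->
  [seq z <- word3 | (z == x) || (z == y)] =
  (one x 0 ++ one y 0) ++ (one x 1 ++ one y 1) ++ (one x 2 ++ one y 2).
Proof. by move=> xy; rewrite !filter_cat !filter_cls. Qed.

Lemma filter_rword3 x y : col x != col y ->
  [seq z <- rword3 | (z == x) || (z == y)] =
  (one x 0 ++ one y 0) ++ (one x 1 ++ one y 1) ++ (one x 2 ++ one y 2).
Proof. by move=> xy; rewrite !filter_cat !filter_rcls. Qed.

Lemma ones_lt x y : (col x < col y)%N ->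
  (one x 0 ++ one y 0) ++ (one x 1 ++ one y 1) ++ (one x 2 ++ one y 2) = [:: x; y].
Proof.
by rewrite /one; case: (col x) => [[|[|[|?]]] //= ?]; case: (col y) => [[|[|[|?]]] //= ?].
Qed.

Lemma filter_block u v x y : next_col u v -> (col x < col y)%N -> [set x; y] != [set u; v] ->
  [seq z <- block u v | (z == x) || (z == y)] = [:: x; y; x; y].
Proof.
move=> uv cxy ne.
have cne : col x != col y by rewrite -val_eqE neq_ltn cxy.
have xy : x != y by apply: contraNneq cne => ->.
have o := ones_lt cxy.
have H i j : i != j -> val (col u) = i -> val (col v) = j ->
  [seq z <- swap_at u v i j | (z == x) || (z == y)] =
  (one x i ++ one y i) ++ (one x j ++ one y j) by move=> *; apply: filter_swap.
have H2 : [:: x; y; x; y] = ((one x 0 ++ one y 0) ++ (one x 1 ++ one y 1) ++ (one x 2 ++ one y 2)) ++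
    ((one x 0 ++ one y 0) ++ (one x 1 ++ one y 1) ++ (one x 2 ++ one y 2)) by rewrite o.
move: uv; rewrite /block /next_col H2.
case cu : (val (col u)) => [|[|[|m]]] /eqP cv.
- by rewrite filter_cat (H 0 1 isT cu cv) filter_cat filter_cls// filter_word3// !catA.
- by rewrite filter_cat filter_cls// filter_cat (H 1 2 isT cu cv) filter_word3// !catA.
- by rewrite filter_cat filter_cls// filter_cat filter_cls// filter_cat (H 2 0 isT cu cv) filter_cat !filter_cls// !catA.
- by have := ltn_ord (col u); rewrite /= cu.
Qed.

Lemma path_repeat (x y : 'I_n) m : x != y ->
  path (fun a b => a != b) y (flatten (nseq m [:: x; y; x; y])).
Proof. by move=> xy; elim: m => //= m ->; rewrite xy eq_sym xy. Qed.

Lemma word_edge_lt x y : [set x; y] \in E -> (col x < col y)%N -> alternate word x y.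
Proof.
move=> xyE cxy.
have cne : col x != col y by rewrite -val_eqE neq_ltn cxy.
have xy : x != y by apply: contraNneq cne => ->.
rewrite /alternate /word 2!filter_cat filter_word3// filter_rword3// ones_lt//.
rewrite filter_flatten -map_comp.
set bl := map _ _; suff -> : bl = nseq (size bl) [:: x; y; x; y].
  have := @path_repeat x y (size bl).+1 xy; rewrite /=.
  by case/andP.
apply/all_pred1P/allP => s /mapP[[u v]]; rewrite mem_filter /= => /andP[/andP[uv nE] _] ->.
by rewrite /= filter_block//; apply: contraNneq nE => <-.
Qed.

Lemma sorted_infix (T : eqType) (s1 s2 s3 : seq T) :
  sorted (fun a b => a != b) (s1 ++ s2 ++ s3) -> sorted (fun a b => a != b) s2.
Proof. by move/cat_sorted2 => [_ /cat_sorted2[]]. Qed.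

(** On {u, v} the block of (u, v) reads v u u v, or v v u u if the exchange takes place between the
    two copies; either way a letter is repeated. *)
Lemma word_nonedge_col u v : next_col u v -> [set u; v] \notin E -> ~~ alternate word u v.
Proof.
move=> uv nE; apply/negP; rewrite /alternate /word filter_cat => /cat_sorted2[_].
have uvin : (u, v) \in [seq uv <- [seq (u, v) | u <- enum 'I_n, v <- enum 'I_n] |
    next_col uv.1 uv.2 && ([set uv.1; uv.2] \notin E)].
  by rewrite mem_filter /= uv nE /=; apply/allpairsP; exists (u, v); rewrite !mem_enum.
case/splitPr: uvin => l1 l2; rewrite map_cat flatten_cat /= !filter_cat => /sorted_infix.
have cne : col u != col v.
  rewrite -val_eqE; move: uv; rewrite /next_col /=.
  by case: (col u) => [[|[|[|?]]] //= ?] /eqP ->.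
have uv' : u != v by apply: contraNneq cne => ->.
have hs i j : val (col u) = i -> val (col v) = j -> i != j ->
    [seq z <- swap_at u v i j | (z == u) || (z == v)] = [:: v; u].
  move=> ui vj ij; rewrite /swap_at !filter_cat /= !eqxx orbT /=.
  have fC (w : 'I_n) k : [seq z <- [seq z <- cls k | z != w] | (z == u) || (z == v)] =
    [seq z <- one u k ++ one v k | z != w].
    rewrite -filter_cls// -[LHS]filter_predI -[RHS]filter_predI; by apply: eq_filter => z /=; rewrite andbC.
  have ji : (j == i) = false by rewrite eq_sym (negbTE ij).
  by rewrite !fC /one ui vj ji (negbTE ij) !eqxx /= !eqxx.
have f3 := filter_word3 cne; have fc i := filter_cls i cne.
move: uv; rewrite /next_col /block.
case cu : (val (col u)) => [|[|[|m]]] /eqP cv.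
- by rewrite filter_cat (hs 0 1 cu cv isT) filter_cat f3 fc /one cu cv /= eqxx /= !andbF.
- by rewrite filter_cat fc filter_cat (hs 1 2 cu cv isT) f3 /one cu cv /= eqxx /= !andbF.
- by rewrite filter_cat fc filter_cat fc filter_cat (hs 2 0 cu cv isT) /one cu cv /= eqxx.
- by have := ltn_ord (col u); rewrite /= cu.
Qed.

Lemma alternateC (w : seq 'I_n) x y : alternate w x y = alternate w y x.
Proof. by rewrite /alternate; congr sorted; apply: eq_filter => z; rewrite orbC. Qed.

(** On two letters of one class, [rword3] is the reversal of [word3], so the letter at the junction
    is repeated. *)
Lemma word_nonedge_same x y : x != y -> col x = col y -> ~~ alternate word x y.
Proof.
move=> xy cxy; apply/negP; rewrite /alternate /word filter_cat => /cat_sorted2[h _].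
move: h; rewrite filter_cat.
have f0 i : i != val (col x) -> [seq z <- cls i | (z == x) || (z == y)] = [::].
  move=> ix; apply/eqP; rewrite -size_eq0 size_filter -leqn0 leqNgt -has_count.
  apply/hasPn => z; rewrite mem_cls => /eqP zi; rewrite negb_or.
  by apply/andP; split; apply: contraNneq ix => e; rewrite -zi e ?cxy.
set s := [seq z <- cls (col x) | (z == x) || (z == y)].
have f1 : [seq z <- word3 | (z == x) || (z == y)] = s.
  rewrite !filter_cat /s.
  case: (col x) f0 => [[|[|[|?]]] //= ?] f0.
  - by rewrite (f0 1)// (f0 2)// ?cats0.
  - by rewrite (f0 0)// (f0 2)// ?cats0.
  - by rewrite (f0 0)// (f0 1)// ?cats0.
have f2 : [seq z <- rword3 | (z == x) || (z == y)] = rev s.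
  rewrite !filter_cat !filter_rev /s.
  case: (col x) f0 => [[|[|[|?]]] //= ?] f0.
  - by rewrite (f0 1)// (f0 2)// ?cats0.
  - by rewrite (f0 0)// (f0 2)// ?cats0.
  - by rewrite (f0 0)// (f0 1)// ?cats0.
rewrite f1 f2; have : x \in s by rewrite mem_filter eqxx mem_cls eqxx.
case/lastP: s {f1 f2} => // s z _; rewrite rev_rcons cat_rcons => /cat_sorted2[_] /=.
by rewrite eqxx.
Qed.

Lemma three_colourable_wr : word_representable E.
Proof.
split=> //; exists word; split.
  move=> x; rewrite mem_cat; apply/orP; left; rewrite mem_cat; apply/orP; left.
  by rewrite !mem_cat !mem_cls; case: (col x) => [[|[|[|?]]] //= ?].
move=> x y xy; split=> [xyE|].
  have := proper xy xyE; rewrite -val_eqE neq_ltn => /orP[] h.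
    exact: word_edge_lt.
  by rewrite alternateC; apply: word_edge_lt => //; rewrite setUC.
apply: contraLR => nE.
have [e|ne] := eqVneq (col x) (col y); first exact: word_nonedge_same.
have : next_col x y || next_col y x.
  move: ne; rewrite /next_col -val_eqE /=.
  by case: (col x) => [[|[|[|?]]] //= ?]; case: (col y) => [[|[|[|?]]] //= ?].
case/orP => h; first exact: word_nonedge_col.
by rewrite alternateC; apply: word_nonedge_col; rewrite // setUC.
Qed.
End ThreeColour.

Local Open Scope ring_scope.

(** * Coloured reduced graphs *)

Section Colour.
Variables (R : realFieldType) (k : nat) (N B : rel 'I_k).
Hypotheses (Nsym : symmetric N) (Bsym : symmetric B).
Hypothesis diag : forall a b c d : 'I_k, (a < b < c)%N -> (c < d)%N ->
  N a b -> N b c -> N c d -> N a d -> B a c && B b d.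

(** White pairs weigh -2, black pairs 0 and gray pairs 1, so an O(k) bound on the total weight is
    the inequality #gray <= 2 #white + O(k). *)
Definition cweight (u v : 'I_k) : R :=
  if u == v then 0 else if ~~ N u v then - 2 else if B u v then 0 else 1.

Lemma cweightC u v : cweight u v = cweight v u.
Proof. by rewrite /cweight eq_sym Nsym Bsym. Qed.

Definition nclique (Q : {set 'I_k}) : bool :=
  [forall x in Q, forall y in Q, (x != y) ==> N x y].

Lemma ncliqueP (Q : {set 'I_k}) : reflect {in Q &, forall x y, x != y -> N x y} (nclique Q).
Proof.
apply: (iffP forall_inP) => [h x y xQ yQ | h x xQ].
  by move/forall_inP: (h x xQ) => /(_ y yQ)/implyP.
by apply/forall_inP => y yQ; apply/implyP; apply: h.
Qed.

(* In an ordered 4-clique every vertex lies on exactly one of the two black diagonals. *)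
Lemma clique_gray_le2 (Q : {set 'I_k}) v : nclique Q -> v \in Q ->
  (#|[set q in Q | (q != v) && ~~ B v q]| <= 2)%N.
Proof.
move=> /ncliqueP clQ vQ; rewrite leqNgt; apply/negP.
case/card_gt2P => x [y [z [[]]]]; rewrite !inE.
move=> /and3P[xQ xv xB] /and3P[yQ yv yB] /and3P[zQ zv zB] [xy yz zx].
have lt_neq (a b : 'I_k) : (a < b)%N -> a != b by move=> ab; rewrite -val_eqE neq_ltn ab.
have H a b c d : a \in Q -> b \in Q -> c \in Q -> d \in Q ->
    (a < b)%N -> (b < c)%N -> (c < d)%N -> B a c && B b d.
  move=> aQ bQ cQ dQ ab bc cd; apply: diag; rewrite ?ab ?bc//; apply: clQ => //; apply: lt_neq => //.
  exact: ltn_trans (ltn_trans ab bc) cd.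
have key p q r : p \in Q -> q \in Q -> r \in Q -> ~~ B v p -> ~~ B v q -> ~~ B v r ->
    p != v -> q != v -> r != v -> (p < q)%N -> (q < r)%N -> False.
  move=> pQ qQ rQ pB qB rB pv qv rv pq qr.
  have [vp|pv'|/val_inj e] := ltngtP v p; last by rewrite e eqxx in pv.
    by have := H v p q r vQ pQ qQ rQ vp pq qr; rewrite (negbTE qB).
  have [vq|vq|/val_inj e] := ltngtP v q; last by rewrite e eqxx in qv.
    by have := H p v q r pQ vQ qQ rQ pv' vq qr; rewrite (negbTE rB) andbF.
  have [vr|vr|/val_inj e] := ltngtP v r; last by rewrite e eqxx in rv.
    by have := H p q v r pQ qQ vQ rQ pq vq vr; rewrite [B p v]Bsym (negbTE pB).
  by have := H p q r v pQ qQ rQ vQ pq qr vr; rewrite [B q v]Bsym (negbTE qB) andbF.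
have [xy'|xy'|/val_inj e] := ltngtP x y; last by rewrite e eqxx in xy.
  have [yz'|yz'|/val_inj e] := ltngtP y z; last by rewrite e eqxx in yz.
    exact: (key x y z).
  have [zx'|zx'|/val_inj e] := ltngtP z x; last by rewrite e eqxx in zx.
    exact: (key z x y).
  exact: (key x z y).
have [yz'|yz'|/val_inj e] := ltngtP y z; last by rewrite e eqxx in yz.
  have [zx'|zx'|/val_inj e] := ltngtP z x; last by rewrite e eqxx in zx.
    exact: (key y z x).
  exact: (key y x z).
exact: (key z y x).
Qed.

Lemma cweight_clique_row (Q : {set 'I_k}) v : nclique Q -> v \in Q ->
  \sum_(q in Q) cweight v q <= 2.
Proof.
move=> clQ vQ; have := clique_gray_le2 clQ vQ; set S := [set q in Q | _] => cS.
apply: (@le_trans _ _ (\sum_(q in Q) (q \in S)%:R)).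
  apply: ler_sum => q qQ; rewrite inE qQ /= /cweight eq_sym.
  case: eqVneq => //= qv.
  by have /ncliqueP := clQ => /(_ v q vQ qQ) ->; [case: (B v q)|rewrite eq_sym].
rewrite -natr_sum -[2]/(2%:R) ler_nat (leq_trans _ cS)//.
rewrite -sum1_card big_mkcond [in X in (_ <= X)%N]big_mkcond /=; apply: leq_sum => i _.
by rewrite inE; case: (i \in Q) => //=; case: (_ && _).
Qed.

(** By maximality v has a white partner in Q, of weight -2. Together with its non-white partners in
    Q, v forms a clique, where its gray pairs contribute at most 2. *)
Lemma cweight_max_row (S Q : {set 'I_k}) v :
  maxset (fun Q => (Q \subset S) && nclique Q) Q -> v \in S :\: Q ->
  \sum_(q in Q) cweight v q <= 0.
Proof.
move=> /maxsetP[/andP[QS clQ] maxQ]; rewrite inE => /andP[vQ vS].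
have /exists_inP[w wQ nvw] : [exists q in Q, ~~ N v q].
  apply: contraT => /exists_inPn h.
  have hN q : q \in Q -> N v q by move=> qQ; apply/negPn/h.
  have : v |: Q = Q.
    apply: maxQ; last exact: subsetUr.
    apply/andP; split; first by rewrite subUset sub1set vS.
    apply/ncliqueP => x y; rewrite !inE => /orP[/eqP->|xQ] /orP[/eqP->|yQ].
    - by rewrite eqxx.
    - by move=> _; apply: hN.
    - by move=> _; rewrite Nsym; apply: hN.
    - by move/ncliqueP: clQ; apply.
  by move=> e; move: vQ; rewrite -e setU11.
pose T := v |: [set q in Q | N v q].
have clT : nclique T.
  apply/ncliqueP => x y; rewrite !inE => /orP[/eqP->|/andP[xQ xN]] /orP[/eqP->|/andP[yQ yN]] //.
  - by rewrite eqxx.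
  - by rewrite Nsym.
  - by move/ncliqueP: clQ; apply.
have vT : v \in T by rewrite setU11.
have := cweight_clique_row clT vT.
rewrite big_setU1 ?inE ?(negbTE vQ)//= {1}/cweight eqxx add0r => h.
rewrite (bigID (fun q => N v q)) /=.
rewrite (eq_bigl (fun q => q \in [set q in Q | N v q])); last by move=> q; rewrite inE.
have h' : \sum_(i in Q | ~~ N v i) cweight v i <= - 2.
  rewrite (bigD1 w) ?wQ ?nvw//= {1}/cweight.
  have -> : (v == w) = false by apply/eqP => e; rewrite e wQ in vQ.
  rewrite nvw -[leRHS]addr0 lerD2l; apply: sumr_le0 => i /andP[/andP[iQ iN] _].
  by rewrite /cweight iN; case: (v == i); lra.
move: h h'; set s1 := \sum_(i in [set q in Q | N v q]) _; set s2 := \sum_(i in Q | _) _; lra.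
Qed.

(** Strong induction on the size of S: a maximal clique Q contributes at most 2 per vertex, the
    pairs between Q and the rest contribute at most 0 in either direction, and the rest is a smaller
    instance. *)
Lemma cweight_sum_set (S : {set 'I_k}) :
  \sum_(u in S) \sum_(v in S) cweight u v <= 2 * #|S|%:R.
Proof.
have [m le_m] := ubnP #|S|; elim: m => // m IH in S le_m *.
have [->|[x0 x0S]] := set_0Vmem S; first by rewrite big_set0 cards0 mulr0.
have [Q maxQ x0Q] : {Q | maxset (fun Q => (Q \subset S) && nclique Q) Q & [set x0] \subset Q}.
  apply: maxset_exists; rewrite sub1set x0S /=; apply/ncliqueP => x y.
  by rewrite !inE => /eqP-> /eqP->; rewrite eqxx.
have /maxsetP[/andP[QS clQ] _] := maxQ.
have Q0 : (0 < #|Q|)%N by apply/card_gt0P; exists x0; rewrite -sub1set.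
have cS : #|S| = (#|Q| + #|S :\: Q|)%N by rewrite -(cardsID Q S) (setIidPr QS).
have split (f : 'I_k -> R) : \sum_(u in S) f u = \sum_(u in Q) f u + \sum_(u in S :\: Q) f u.
  by rewrite (big_setID Q) /= (setIidPr QS).
have h1 : \sum_(u in S :\: Q) \sum_(v in S :\: Q) cweight u v <= 2 * #|S :\: Q|%:R.
  by apply: IH; move: le_m; rewrite cS ltnS; apply: leq_trans; rewrite -[X in (X < _)%N]add0n ltn_add2r.
have h2 : \sum_(u in Q) \sum_(v in Q) cweight u v <= 2 * #|Q|%:R.
  rewrite mulrC mulr_natl -sumr_const; apply: ler_sum => u uQ; exact: cweight_clique_row.
have h3 : \sum_(u in S :\: Q) \sum_(v in Q) cweight u v <= 0.
  apply: sumr_le0 => u uQ; exact: (cweight_max_row maxQ).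
have h4 : \sum_(u in Q) \sum_(v in S :\: Q) cweight u v <= 0.
  rewrite exchange_big /=; apply: le_trans h3; apply: ler_sum => u _.
  by apply: ler_sum => v _; rewrite cweightC.
rewrite split; under eq_bigr do rewrite split.
under [X in _ + X]eq_bigr do rewrite split.
rewrite !big_split /= cS natrD; lra.
Qed.

Lemma cweight_sum : \sum_u \sum_v cweight u v <= 2 * k%:R.
Proof.
have := cweight_sum_set [set: 'I_k]; rewrite cardsT card_ord.
by under eq_bigr do under eq_bigl do rewrite inE; under eq_bigl do rewrite inE.
Qed.
End Colour.

(** * Density and embedding *)

Section Density.
Variables (R : realFieldType) (V : finType).
Implicit Types (X : rel V) (A B : {set V}).

Definition ecount X A B : R := \sum_(x in A) \sum_(y in B) (X x y)%:R.

Definition nbrs X x B := [set y in B | X x y].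

Lemma ecountE X A B : ecount X A B = \sum_(x in A) #|nbrs X x B|%:R.
Proof.
apply: eq_bigr => x _; rewrite -natr_sum -sum1_card; congr _%:R.
rewrite big_mkcond [RHS]big_mkcond; apply: eq_bigr => y _.
by rewrite inE; case: (y \in B) => //=; case: (X x y).
Qed.

Lemma ecount_ge0 X A B : 0 <= ecount X A B.
Proof. by apply: sumr_ge0 => x _; apply: sumr_ge0 => y _; rewrite ler0n. Qed.

Lemma ecount_sub X A B A' B' : A' \subset A -> B' \subset B -> ecount X A' B' <= ecount X A B.
Proof.
move=> sA sB; rewrite /ecount (big_setID A' (A := A)) /= (setIidPr sA) -[leLHS]addr0.
apply: lerD; last by apply: sumr_ge0 => x _; apply: sumr_ge0 => y _; rewrite ler0n.
apply: ler_sum => x _; rewrite (big_setID B' (A := B)) /= (setIidPr sB) -[leLHS]addr0.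
by apply: lerD => //; apply: sumr_ge0 => y _; rewrite ler0n.
Qed.

Lemma ecountC X A B : symmetric X -> ecount X A B = ecount X B A.
Proof.
move=> sX; rewrite /ecount exchange_big; apply: eq_bigr => y _; apply: eq_bigr => x _.
by rewrite sX.
Qed.

(** Only a lower bound on the density of large subpairs is asked, not regularity; its failure
    directly yields a large sparse subpair. *)
Definition hdense (rho tau : R) X A B := forall A' B', A' \subset A -> B' \subset B ->
  rho * #|A|%:R <= #|A'|%:R -> rho * #|B|%:R <= #|B'|%:R ->
  tau * (#|A'|%:R * #|B'|%:R) <= ecount X A' B'.

Definition low (delta : R) X A B := ecount X A B <= delta * (#|A|%:R * #|B|%:R).

Lemma hdense_weak rho tau rho' tau' X A B : rho <= rho' -> tau' <= tau ->
  hdense rho tau X A B -> hdense rho' tau' X A B.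
Proof.
move=> hr ht h A' B' sA sB cA cB; apply: (le_trans _ (h A' B' sA sB _ _)).
- by apply: ler_wpM2r => //; apply: mulr_ge0; rewrite ler0n.
- by apply: le_trans cA; apply: ler_wpM2r => //; rewrite ler0n.
- by apply: le_trans cB; apply: ler_wpM2r => //; rewrite ler0n.
Qed.

(** Otherwise the vertices with few neighbours in B' would form, with B', a large subpair that is
    too sparse. *)
Lemma few_bad rho tau X A B B' : hdense rho tau X A B -> 0 < rho -> B' \subset B ->
  rho * #|B|%:R <= #|B'|%:R -> (0 < #|A|)%N ->
  #|[set x in A | #|nbrs X x B'|%:R < tau * #|B'|%:R]|%:R < rho * #|A|%:R.
Proof.
move=> h r0 sB cB A0; set A' := [set x in A | _]; rewrite ltNge; apply/negP => cA.
have A'0 : 0 < #|A'|%:R :> R by apply: lt_le_trans cA; rewrite mulr_gt0 ?ltr0n.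
have sA : A' \subset A by apply/fintype.subsetP => x; rewrite inE => /andP[].
have := h _ _ sA sB cA cB; rewrite leNgt => /negP; apply.
rewrite ecountE mulrCA mulr_natl -sumr_const; apply: ltr_sum.
  by move: A'0; rewrite ltr0n => /card_gt0P[x xA]; apply/hasP; exists x; rewrite ?mem_index_enum.
by move=> x; rewrite inE => /andP[].
Qed.

Lemma pick_good (S B1 B2 B3 : {set V}) :
  (#|B1| + #|B2| + #|B3| < #|S|)%N ->
  exists x, [/\ x \in S, x \notin B1, x \notin B2 & x \notin B3].
Proof.
move=> h; have /card_gt0P[x] : (0 < #|S :\: (B1 :|: B2 :|: B3)|)%N.
  rewrite -subn_gt0 in h *; apply: leq_trans h _; rewrite cardsD leq_sub2l//.
  apply: leq_trans (subset_leq_card (subsetIr _ _)) _.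
  by apply: leq_trans (leq_card_setU _ _).1 _; rewrite leq_add2r (leq_card_setU _ _).1.
by rewrite !inE !negb_or => /andP[/andP[/andP[h1 h2] h3] xS]; exists x.
Qed.

Lemma sq_le_mul (y t u : R) : 0 < y -> y <= t -> y <= u -> y ^+ 2 <= t * u.
Proof. by move=> y0 yt yu; rewrite expr2; apply: ler_pM => //; apply: ltW. Qed.

Lemma three_small (y s u v w : R) : y <= 1/16 -> 0 < s -> u < y * s -> v < y * s -> w < y * s ->
  u + v + w < s.
Proof.
move=> y1 s0; have : y * s <= 1/16 * s by rewrite ler_wpM2r// ltW.
lra.
Qed.

Lemma two_small (y t s u v : R) : 0 < y -> y <= 1/4 -> y <= t -> 0 < s ->
  u < y ^+ 2 * s -> v < y ^+ 2 * s -> u + v < t * s.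
Proof.
move=> y0 y1 yt s0.
have h1 : y ^+ 2 * s <= 1/4 * t * s.
  by rewrite ler_wpM2r ?(ltW s0)// expr2; apply: ler_pM => //; apply: ltW.
have h2 : 0 < t * s by rewrite mulr_gt0//; apply: lt_le_trans yt.
lra.
Qed.

(* The clusters are used up in the order A, B, C, D; the hypotheses [yb <= ta] and [yc <= tb]
   say that a pair stays dense at the scale reached after the earlier choices. *)
Lemma embed4 Xab Xac Xad Xbc Xbd Xcd A B C D (ya ta yb tb yc tc : R) :
  0 < ya -> ya <= 1/4 -> 0 < ta -> yb <= ta -> ta <= 1/4 -> 0 < tb -> tb <= yb ->
  0 < yc -> yc <= tb -> 0 < tc ->
  hdense (ya^+2) ta Xab A B -> hdense (ya^+2) ta Xac A C -> hdense (ya^+2) ta Xad A D ->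
  hdense (yb^+2) tb Xbc B C -> hdense (yb^+2) tb Xbd B D -> hdense (yc^+2) tc Xcd C D ->
  (0 < #|A|)%N -> (0 < #|B|)%N -> (0 < #|C|)%N -> (0 < #|D|)%N ->
  exists a b c d, [/\ [/\ a \in A, b \in B, c \in C & d \in D],
    [/\ Xab a b, Xac a c & Xad a d], Xbc b c, Xbd b d & Xcd c d].
Proof.
move=> ya0 ya1 ta0 ybta ta1 tb0 tbyb yc0 yctb tc0 hab hac had hbc hbd hcd A0 B0 C0 D0.
have full r (S : {set V}) : r <= 1 -> r * #|S|%:R <= #|S|%:R :> R.
  by move=> r1; rewrite -[leRHS]mul1r ler_wpM2r ?ler0n.
have ya2 : ya ^+ 2 <= 1/16.
  by apply: le_trans (sq_le_mul ya0 ya1 ya1) _; clear; lra.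
have ya21 : ya ^+ 2 <= 1 by apply: le_trans ya2 _; clear; lra.
have ya20 : 0 < ya ^+ 2 by rewrite exprn_gt0.
have pos (S : {set V}) : (0 < #|S|)%N -> 0 < #|S|%:R :> R by rewrite ltr0n.
(* Each of B, C, D excludes a proportion below ya ^ 2 <= 1/16 of A, so a good vertex remains. *)
have [a [aA aB aC aD]] : exists a, [/\ a \in A,
    ta * #|B|%:R <= #|nbrs Xab a B|%:R :> R, ta * #|C|%:R <= #|nbrs Xac a C|%:R :> R
    & ta * #|D|%:R <= #|nbrs Xad a D|%:R :> R].
  have fB := few_bad hab ya20 (fintype.subxx B) (full _ _ ya21) A0.
  have fC := few_bad hac ya20 (fintype.subxx C) (full _ _ ya21) A0.
  have fD := few_bad had ya20 (fintype.subxx D) (full _ _ ya21) A0.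
  have [|a [aA aB aC aD]] := pick_good (S := A)
    (B1 := [set x in A | #|nbrs Xab x B|%:R < ta * #|B|%:R])
    (B2 := [set x in A | #|nbrs Xac x C|%:R < ta * #|C|%:R])
    (B3 := [set x in A | #|nbrs Xad x D|%:R < ta * #|D|%:R]).
    by rewrite -(ltr_nat R) !natrD; apply: (three_small ya2 (pos _ A0)).
  exists a; move: aB aC aD; rewrite !inE aA /= -!leNgt => *; split => //.
set NB := nbrs Xab a B in aB; set NC := nbrs Xac a C in aC; set ND := nbrs Xad a D in aD.
have sub X x (S : {set V}) : nbrs X x S \subset S by apply/fintype.subsetP => y; rewrite inE => /andP[].
have yb0 : 0 < yb := lt_le_trans tb0 tbyb.
have yb1 : yb <= 1/4 := le_trans ybta ta1.
have ybta2 : yb ^+ 2 <= ta.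
  apply: le_trans (sq_le_mul yb0 ybta yb1) _; rewrite ler_piMr ?(ltW ta0)//; clear; lra.
have yctbta : yc ^+ 2 <= tb * ta.
  by apply: sq_le_mul => //; apply: le_trans ybta; apply: le_trans tbyb.
have yb20 : 0 < yb ^+ 2 by rewrite exprn_gt0.
have shr (S : {set V}) (N : {set V}) r t : r <= t -> t * #|S|%:R <= #|N|%:R ->
    r * #|S|%:R <= #|N|%:R :> R.
  by move=> rt; apply: le_trans; rewrite ler_wpM2r ?ler0n.
(* Now b must lie among the neighbours of a, a proportion of at least ta >= yb of B, while C and D
   exclude a proportion below 2 yb ^ 2 <= yb / 2 of B. *)
have [b [bN bC bD]] : exists b, [/\ b \in NB,
    tb * #|NC|%:R <= #|nbrs Xbc b NC|%:R :> R & tb * #|ND|%:R <= #|nbrs Xbd b ND|%:R :> R].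
  have fC := few_bad hbc yb20 (sub _ _ _ : NC \subset C)
    (shr _ _ _ _ ybta2 aC) B0.
  have fD := few_bad hbd yb20 (sub _ _ _ : ND \subset D)
    (shr _ _ _ _ ybta2 aD) B0.
  have [|b [bN bC bD _]] := pick_good (S := NB)
    (B1 := [set x in B | #|nbrs Xbc x NC|%:R < tb * #|NC|%:R])
    (B2 := [set x in B | #|nbrs Xbd x ND|%:R < tb * #|ND|%:R]) (B3 := set0).
    rewrite cards0 addn0 -(ltr_nat R) natrD.
    by apply: lt_le_trans aB; apply: (two_small yb0 yb1 ybta (pos _ B0)).
  have bB : b \in B := fintype.subsetP (sub _ _ _) _ bN.
  by exists b; split => //; [move: bC|move: bD]; rewrite inE bB /= -leNgt.
set NC' := nbrs Xbc b NC in bC; set ND' := nbrs Xbd b ND in bD.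
(* The candidates for c and d still have proportion at least tb * ta >= yc ^ 2, where [Xcd] is
   dense. *)
have cd : 0 < ecount Xcd NC' ND'.
  have tC : 0 < #|NC'|%:R :> R.
    by apply: lt_le_trans bC; rewrite mulr_gt0//; apply: lt_le_trans aC; rewrite mulr_gt0// pos.
  have tD : 0 < #|ND'|%:R :> R.
    by apply: lt_le_trans bD; rewrite mulr_gt0//; apply: lt_le_trans aD; rewrite mulr_gt0// pos.
  apply: lt_le_trans (hcd NC' ND' _ _ _ _).
  - by rewrite !mulr_gt0.
  - exact: fintype.subset_trans (sub _ _ _) (sub _ _ _).
  - exact: fintype.subset_trans (sub _ _ _) (sub _ _ _).
  - apply: (shr _ _ _ (tb * ta)); first exact: yctbta.
    by apply: le_trans bC; rewrite -mulrA ler_wpM2l// ltW.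
  - apply: (shr _ _ _ (tb * ta)); first exact: yctbta.
    by apply: le_trans bD; rewrite -mulrA ler_wpM2l// ltW.
have /exists_inP[c cN /exists_inP[d dN cdX]] : [exists c in NC', exists d in ND', Xcd c d].
  apply: contraLR cd => /exists_inPn h; rewrite -leNgt; apply: sumr_le0 => c cN.
  apply: sumr_le0 => d dN; have /exists_inPn := h c cN => /(_ d dN).
  by move/negbTE ->.
by move: bN cN dN; rewrite !inE => /andP[bB ab] /andP[/andP[cC ac] bc] /andP[/andP[dD ad] bd];
  exists a, b, c, d.
Qed.
End Density.

(** * Almost optimal cylinders *)

Section Scales.
Variables (R : realFieldType) (x : R).
Hypotheses (x0 : 0 < x) (x1 : x <= 1).

(** In one decision at scale y, passing to a sparse subpair costs a factor y ^ 3 and all remaining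
    decisions together cost y, hence the fourth power. *)
Definition scale l := iter l (fun y : R => y ^+ 4) x.

Lemma scale_gt0 l : 0 < scale l.
Proof. by elim: l => //= l IH; rewrite exprn_gt0. Qed.

Lemma scale_le l : scale l <= x.
Proof.
elim: l => //= l IH; apply: le_trans IH; rewrite exprS ler_piMr ?(ltW (scale_gt0 l))//.
rewrite exprn_ile1// ?(ltW (scale_gt0 l))//.
by elim: l => //= l IH; rewrite exprn_ile1// ltW// scale_gt0.
Qed.

Lemma scale_le1 l : scale l <= 1.
Proof. exact: le_trans (scale_le l) x1. Qed.

Lemma scale_anti l m : (l <= m)%N -> scale m <= scale l.
Proof.
move/subnK <-; elim: (m - l)%N => // d IH; apply: le_trans IH.
rewrite addSn /= exprS ler_piMr ?(ltW (scale_gt0 _))//.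
by rewrite exprn_ile1// ?scale_le1// ltW// scale_gt0.
Qed.
End Scales.

Section Cylinder.
Variables (R : realFieldType) (V : finType).
Implicit Types (W : nat -> {set V}).

Definition subcyl (z : R) W' W := forall i, W' i \subset W i /\ z * #|W i|%:R <= #|W' i|%:R.

Lemma subcyl_trans z z' W W' W'' : 0 <= z' -> 
  subcyl z' W'' W' -> subcyl z W' W -> subcyl (z' * z) W'' W.
Proof.
move=> z0 h1 h2 i; have [s1 c1] := h1 i; have [s2 c2] := h2 i.
split; first exact: fintype.subset_trans s1 s2.
by apply: le_trans c1; rewrite -mulrA ler_wpM2l.
Qed.

Lemma subcyl_weak z z' W W' : z <= z' -> subcyl z' W' W -> subcyl z W' W.
Proof.
move=> zz h i; have [s c] := h i; split=> //; apply: le_trans c.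
by rewrite ler_wpM2r.
Qed.

Lemma subcyl_refl z W : z <= 1 -> subcyl z W W.
Proof. by move=> z1 i; split=> //; rewrite ler_piMl ?ler0n. Qed.

Definition upd W m A : nat -> {set V} := fun i => if i == m then A else W i.

(* The pairs are decided in order of decreasing index, each at a much finer scale than the later
   ones: a sparse pair stays sparse, and a hereditarily dense one stays so, under the shrinking
   caused by the remaining decisions. *)
Lemma decide x delta (it : nat -> nat * nat) (X : nat -> rel V) M W :
  0 < x -> x <= 1 -> x <= delta ->
  exists2 W', subcyl (scale x M) W' W &
    forall l, (l < M)%N -> ((it l).1 < (it l).2)%N ->
      low delta (X l) (W' (it l).1) (W' (it l).2) \/
      hdense (scale x l ^+ 2) (scale x l.+1) (X l) (W' (it l).1) (W' (it l).2).
Proof.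
move=> x0 x1 xd; elim: M W => [|M IH] W.
  by exists W => //; apply: subcyl_refl.
set y := scale x M; have y0 : 0 < y := scale_gt0 x0 M.
have y1 : y <= 1 := scale_le1 x0 x1 M; have yd : y <= delta := le_trans (scale_le x0 x1 M) xd.
have yE : scale x M.+1 = y ^+ 4 by [].
set i := (it M).1; set j := (it M).2.
have y4y : y ^+ 4 <= y by rewrite -yE; apply: scale_anti.
have lastM (P : nat -> Prop) : (forall l, (l < M)%N -> P l) -> P M -> forall l, (l < M.+1)%N -> P l.
  by move=> h hM l; rewrite ltnS leq_eqVlt => /orP[/eqP->|/h].
have [ij|ij] := ltnP i j; last first.
  have [W' sW hW] := IH W; exists W'; first exact: subcyl_weak sW.
  by apply: lastM => //; rewrite -/i -/j; lia.
(* The remaining decisions keep a proportion of at least y. So a dense pair stays dense with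
   threshold y ^ 2 in place of y ^ 3, and a density below y ^ 4 rises to at most y ^ 4 / y ^ 2 = y ^
   2 <= delta. *)
have [hd|nhd] := pselect (hdense (y ^+ 3) (y ^+ 4) (X M) (W i) (W j)).
  have [W' sW hW] := IH W; exists W'; first exact: subcyl_weak sW.
  apply: lastM => // _; right; rewrite -/i -/j yE -/y.
  have [si ci] := sW i; have [sj cj] := sW j.
  move=> A B sA sB cA cB; apply: hd.
  - exact: fintype.subset_trans sA si.
  - exact: fintype.subset_trans sB sj.
  - by apply: le_trans cA; rewrite exprSr -mulrA ler_wpM2l// exprn_ge0// ltW.
  - by apply: le_trans cB; rewrite exprSr -mulrA ler_wpM2l// exprn_ge0// ltW.
move/existsNP: nhd => [A /existsNP[B]].
move=> /not_implyP[sA] /not_implyP[sB] /not_implyP[cA] /not_implyP[cB] /negP.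
rewrite -ltNge => eAB.
pose W1 := upd (upd W i A) j B.
have y3 : y ^+ 3 <= 1 by rewrite exprn_ile1// ltW.
have sW1 : subcyl (y ^+ 3) W1 W.
  move=> l; rewrite /W1 /upd; case: (eqVneq l j) => [->//|_]; case: (eqVneq l i) => [->//|_].
  by split=> //; rewrite ler_piMl.
have [W' sW hW] := IH W1; exists W'.
  by have := subcyl_trans (ltW y0) sW sW1; rewrite -/y -exprS.
apply: lastM => // _; left; rewrite -/i -/j.
have [] := sW i; have [] := sW j; rewrite -/y.
have -> : W1 j = B by rewrite /W1 /upd eqxx.
have -> : W1 i = A by rewrite /W1 /upd eqxx; case: eqP => // e; rewrite e ltnn in ij.
move=> sj cj si ci; apply: le_trans (ecount_sub _ _ si sj) _; apply: ltW.
apply: lt_le_trans eAB _.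
have h : y ^+ 2 * (#|A|%:R * #|B|%:R) <= #|W' i|%:R * #|W' j|%:R.
  by rewrite expr2 mulrACA; apply: ler_pM => //; apply: mulr_ge0 => //; apply: ltW.
apply: (@le_trans _ _ (y ^+ 2 * (#|W' i|%:R * #|W' j|%:R))).
  by rewrite (_ : 4 = 2 + 2)%N // exprD -mulrA ler_wpM2l// exprn_ge0// ltW.
apply: ler_wpM2r; first by rewrite mulr_ge0.
by apply: le_trans yd; rewrite expr2 ler_piMr// ltW.
Qed.

Definition sgn (F : rel V) (b : bool) : rel V := fun u v => F u v == b.

(* Encodes (i, j, b) as 2ki + 2j + b, so that the pairs with small i are the last to be decided
   and have the coarsest scales, as [embed4] requires. *)
Lemma decide_pairs k x delta (F : rel V) W : 0 < x -> x <= 1 -> x <= delta ->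
  exists2 W', subcyl (scale x (2 * k * k)) W' W &
    forall i j b, (i < j)%N -> (j < k)%N ->
      low delta (sgn F b) (W' i) (W' j) \/
      hdense (scale x (2 * k * i) ^+ 2) (scale x (2 * k * i.+1)) (sgn F b) (W' i) (W' j).
Proof.
move=> x0 x1 xd.
have [W' sW h] := decide (fun l => (l %/ (2 * k), (l %% (2 * k))./2)%N)
  (fun l => sgn F (odd (l %% (2 * k)))) (2 * k * k) W x0 x1 xd.
exists W' => // i j b ij jk.
pose r := (b + j.*2)%N; have rk : (r < 2 * k)%N by rewrite /r; case: (b); lia.
have k0 : (0 < 2 * k)%N by lia.
have := h (2 * k * i + r)%N; rewrite /= mulnC divnMDl// modnMDl (modn_small rk) divn_small// addn0.
have -> : odd r = b by rewrite /r oddD odd_double addbF; case: (b).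
have -> : r./2 = j by rewrite /r half_bit_double.
case=> // [|hl|hh]; [|by left|right].
  by have : (2 * k * i.+1 <= 2 * k * k)%N; [rewrite leq_mul2l; lia|rewrite mulnS mulnC; lia].
(* As r < 2k, both scales can be replaced by those at the two ends of row i, which depend on i
   alone. *)
apply: hdense_weak hh.
  apply: lerXn2r; rewrite ?nnegrE ?(ltW (scale_gt0 x0 _))//.
  by apply: scale_anti => //; rewrite mulnC leq_addr.
apply: (@scale_anti R x x0 x1 (i * (2 * k) + r).+1).
by rewrite mulnS mulnC; lia.
Qed.
End Cylinder.

(** * Cost of a cylinder and its near-minimisers *)

Section Cost.
Variables (R : realFieldType) (V : finType) (X : rel V) (k : nat).
Implicit Types (W : nat -> {set V}) (A B : {set V}).

Definition dens A B : R := ecount R X A B / (#|A|%:R * #|B|%:R).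

Definition cost W : R := \sum_(i < k) \sum_(j < k | j != i) dens (W i) (W j).

Lemma dens_ge0 A B : 0 <= dens A B.
Proof. by rewrite divr_ge0 ?ecount_ge0// mulr_ge0. Qed.

Lemma cost_ge0 W : 0 <= cost W.
Proof. by apply: sumr_ge0 => i _; apply: sumr_ge0 => j _; apply: dens_ge0. Qed.

Lemma mul_dens_l A B : #|A|%:R * dens A B = ecount R X A B / #|B|%:R.
Proof.
rewrite /dens invfM mulrCA; have [A0|A0] := eqVneq #|A| 0%N; last first.
  by rewrite mulVKf// pnatr_eq0.
by rewrite (cards0_eq A0) /ecount big_set0 !mul0r.
Qed.

Lemma mul_dens_r A B : #|B|%:R * dens A B = ecount R X A B / #|A|%:R.
Proof.
rewrite /dens invfM mulrCA; have [B0|B0] := eqVneq #|B| 0%N; last first.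
  by rewrite [_^-1 / _]mulrC mulVKf// pnatr_eq0.
rewrite (cards0_eq B0) /ecount big1 ?mul0r// => x _; exact: big_set0.
Qed.

(** The cost is affine in each coordinate: every density involving [W m] is the average of the
    densities of the two pieces, weighted by size, and the sum has no (m, m) term. *)
Lemma cost_split W m A : A \subset W m ->
  #|W m|%:R * cost W = #|A|%:R * cost (upd W m A) + #|W m :\: A|%:R * cost (upd W m (W m :\: A)).
Proof.
move=> sA; have cW : #|W m|%:R = #|A|%:R + #|W m :\: A|%:R :> R.
  by rewrite -natrD -(cardsID A (W m)) (setIidPr sA).
rewrite /cost !mulr_sumr -big_split; apply: eq_bigr => i _.
rewrite !mulr_sumr -big_split; apply: eq_bigr => j ij /=; rewrite /upd.
case: (eqVneq (i : nat) m) => im; case: (eqVneq (j : nat) m) => jm.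
- by case/negP: ij; rewrite -val_eqE /= im jm.
- rewrite im !mul_dens_l -mulrDl; congr (_ / _).
  by rewrite /ecount (big_setID A) /= (setIidPr sA).
- rewrite jm !mul_dens_r -mulrDl; congr (_ / _).
  rewrite /ecount -big_split; apply: eq_bigr => x _.
  by rewrite (big_setID A) /= (setIidPr sA).
- by rewrite cW mulrDl.
Qed.

Definition nearmin (z kappa : R) W := forall W', subcyl z W' W -> cost W - kappa <= cost W'.

(* The cost decreases by kappa at each step and stays nonnegative. *)
Lemma descent (z kappa : R) N W : 0 <= z -> z <= 1 -> 0 <= kappa -> cost W < N%:R * kappa ->
  exists W', [/\ subcyl (z ^+ N) W' W, cost W' <= cost W & nearmin z kappa W'].
Proof.
move=> z0 z1 k0; elim: N W => [|N IH] W; first by rewrite mul0r ltNge cost_ge0.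
move=> hW; have [h|/existsNP[W1 /not_implyP[sW1 /negP]]] := pselect (nearmin z kappa W).
  by exists W; split=> //; apply: subcyl_refl; rewrite exprn_ile1.
rewrite -ltNge => cW1; have [|W' [s c n]] := IH W1.
  by move: hW; rewrite -natr1 mulrDl mul1r; lra.
exists W'; split=> //; last by lra.
by rewrite exprSr; apply: subcyl_trans s sW1; rewrite exprn_ge0.
Qed.

(** Near-minimality is a lower bound, but it also yields an upper one: by [cost_split] the cost is
    an average over [W' m] and its complement, and since the large complement is not much cheaper
    than W, [W' m] is not much dearer. The coordinates are replaced one at a time, each multiplying
    the error by at most 2 / z. *)
Lemma nearmin_upper (z kappa : R) W W' : 0 < z -> z <= 1 -> 0 <= kappa -> nearmin z kappa W ->
  subcyl z W' W -> (forall i, (i < k)%N -> z * #|W i|%:R <= #|W i :\: W' i|%:R) ->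
  (forall i, (i < k)%N -> (0 < #|W i|)%N) ->
  cost W' <= cost W + kappa * (2 / z) ^+ k.
Proof.
move=> z0 z1 k0 nm sW cW pW.
pose mix m : nat -> {set V} := fun i => if (i < m)%N then W' i else W i.
have step m : (m < k)%N -> #|W m|%:R * cost (mix m) =
    #|W' m|%:R * cost (mix m.+1) + #|W m :\: W' m|%:R * cost (upd (mix m) m (W m :\: W' m)).
  move=> mk; have [sm _] := sW m.
  have mm : mix m m = W m by rewrite /mix ltnn.
  have := @cost_split (mix m) m (W' m); rewrite mm => /(_ sm) ->.
  suff -> : upd (mix m) m (W' m) = mix m.+1 by [].
  apply: funext => i; rewrite /upd /mix [in RHS]ltnS [in RHS]leq_eqVlt.
  by case: (eqVneq i m) => [->|_].
(* The -1 absorbs the kappa lost on the complement; division by the proportion z of [W' m] then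
   gives e / z, and e / z <= 2 e / z - 1 restores the form. *)
have bound m : (m <= k)%N -> cost (mix m) <= cost W + kappa * ((2 / z) ^+ m - 1).
  elim: m => [_|m IH mk].
    rewrite expr0 subrr mulr0 addr0 le_eqVlt; apply/orP; left; apply/eqP.
    by congr cost; apply: funext.
  have {}IH := IH (ltnW mk); have st := step m mk.
  have W0 : 0 < #|W m|%:R :> R by rewrite ltr0n pW.
  have [sm cm] := sW m.
  have W'0 : 0 < #|W' m|%:R :> R by apply: lt_le_trans cm; rewrite mulr_gt0.
  have cD : #|W m|%:R = #|W' m|%:R + #|W m :\: W' m|%:R :> R.
    by rewrite -natrD -(cardsID (W' m) (W m)) (setIidPr sm).
  have low : cost W - kappa <= cost (upd (mix m) m (W m :\: W' m)).
    apply: nm => i; rewrite /upd /mix; case: (eqVneq i m) => [->|_].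
      by split; [exact: subsetDl|exact: cW].
    by case: ifP => _; [exact: sW|apply: subcyl_refl].
  set e := (2 / z) ^+ m in IH.
  have e1 : 1 <= e by rewrite exprn_ege1// ler_pdivlMr//; lra.
  have h1 : #|W' m|%:R * cost (mix m.+1) <=
      #|W' m|%:R * cost W + #|W m|%:R * (kappa * e).
    have a1 : #|W m|%:R * cost (mix m) <= #|W m|%:R * (cost W + kappa * (e - 1)).
      by rewrite ler_pM2l.
    have a2 : #|W m :\: W' m|%:R * (cost W - kappa) <=
      #|W m :\: W' m|%:R * cost (upd (mix m) m (W m :\: W' m)) by rewrite ler_wpM2l.
    have a3 : 0 <= #|W' m|%:R * kappa by rewrite mulr_ge0.
    move: a1 a2 a3; rewrite st {1 2}cD; lra.
  have h2 : #|W m|%:R * (kappa * e) <= #|W' m|%:R * (kappa * e / z).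
    have ke : 0 <= kappa * e by rewrite mulr_ge0//; lra.
    have wz : #|W m|%:R <= #|W' m|%:R / z by rewrite ler_pdivlMr// mulrC.
    by apply: le_trans (ler_wpM2r ke wz) _; rewrite -[leLHS]mulrA [z^-1 * _]mulrC.
  have h3 : cost (mix m.+1) <= cost W + kappa * e / z.
    by rewrite -(ler_pM2l W'0) mulrDr; lra.
  apply: le_trans h3 _; rewrite lerD2l exprS -/e -mulrA ler_wpM2l//.
  have : 1 <= e / z by rewrite ler_pdivlMr//; lra.
  by rewrite [2 / z * e]mulrAC -mulrA; lra.
have := bound k (leqnn k).
have -> : cost (mix k) = cost W'.
  by apply: eq_bigr => i _; apply: eq_bigr => j _; rewrite /mix !ltn_ord.
move/le_trans; apply; rewrite lerD2l ler_wpM2l// gerBl//.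
Qed.
End Cost.

Lemma subset_of_card (V : finType) (S : {set V}) m : (m <= #|S|)%N ->
  exists2 A : {set V}, A \subset S & #|A| = m.
Proof.
move=> mS; exists [set x in take m (enum S)].
  by apply/fintype.subsetP => x; rewrite inE => /mem_take; rewrite mem_enum.
rewrite cardsE; have /card_uniqP -> : uniq (take m (enum S)) by rewrite take_uniq ?enum_uniq.
by rewrite size_takel// -cardE.
Qed.

(** * Lower bound for the cost of a cylinder *)

Section Core.
Variables (R : realType) (V : finType).
Implicit Types (X F G : rel V) (A B : {set V}).

Lemma ecount_split F A B :
  ecount R (sgn F true) A B + ecount R (sgn F false) A B = #|A|%:R * #|B|%:R.
Proof.
rewrite -big_split /= mulr_natl -sumr_const; apply: eq_bigr => x _.
rewrite -big_split /= -[RHS]mulr1 mulr_natl -sumr_const; apply: eq_bigr => y _.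
by rewrite /sgn; case: (F x y); rewrite ?addr0 ?add0r.
Qed.

Lemma ecount_le X A B : ecount R X A B <= #|A|%:R * #|B|%:R.
Proof.
rewrite -(ecount_split X A B) -[leLHS]addr0 lerD ?ecount_ge0//.
by apply: ler_sum => x _; apply: ler_sum => y _; rewrite /sgn eqb_id.
Qed.

Lemma dens_le1 X A B : dens R X A B <= 1.
Proof.
rewrite /dens; have [h|h] := eqVneq (#|A|%:R * #|B|%:R : R) 0; first by rewrite h invr0 mulr0.
by rewrite ler_pdivrMr ?mul1r ?ecount_le// lt_neqAle eq_sym h mulr_ge0.
Qed.

Lemma cost_le X k W : cost R X k W <= k%:R ^+ 2.
Proof.
apply: (@le_trans _ _ (\sum_(i < k) \sum_(j < k) (1 : R))).
  apply: ler_sum => i _; rewrite big_mkcond; apply: ler_sum => j _.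
  by case: ifP => _ //; exact: dens_le1.
by rewrite !sumr_const !card_ord expr2 mulr_natr.
Qed.

Definition xorr F G : rel V := fun x y => F x y != G x y.

Lemma ecount_xor_ge F G A B :
  ecount R G A B - ecount R (sgn F true) A B <= ecount R (xorr F G) A B.
Proof.
rewrite lerBlDr -big_split; apply: ler_sum => x _; rewrite -big_split; apply: ler_sum => y _.
by rewrite /xorr /sgn; case: (F x y); case: (G x y) => /=; lra.
Qed.

Lemma ecount_xor_ge' F G A B :
  #|A|%:R * #|B|%:R - ecount R G A B - ecount R (sgn F false) A B <= ecount R (xorr F G) A B.
Proof.
rewrite -(ecount_split G A B) 2!lerBlDr.
rewrite -3!big_split; apply: ler_sum => x _; rewrite -3!big_split; apply: ler_sum => y _.
by rewrite /xorr /sgn; case: (F x y); case: (G x y) => /=; lra.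
Qed.

Section Pattern.
Variables (k : nat) (delta : R) (F : rel V) (W : nat -> {set V}).
Hypotheses (d0 : 0 < delta) (d1 : delta <= 1/4).
Hypothesis W0 : forall i, (i < k)%N -> (0 < #|W i|)%N.
Hypothesis dec : forall i j b, (i < j)%N -> (j < k)%N ->
  low delta (sgn F b) (W i) (W j) \/
  hdense (scale delta (2 * k * i) ^+ 2) (scale delta (2 * k * i.+1)) (sgn F b) (W i) (W j).

(** A sign that is not low is hereditarily dense by [dec], and the scales decrease with the first
    index, as [embed4] requires. *)
Lemma pattern4 a b c d sab sac sad sbc sbd scd : (a < b)%N -> (b < c)%N -> (c < d)%N -> (d < k)%N ->
  ~~ low delta (sgn F sab) (W a) (W b) -> ~~ low delta (sgn F sac) (W a) (W c) ->
  ~~ low delta (sgn F sad) (W a) (W d) -> ~~ low delta (sgn F sbc) (W b) (W c) ->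
  ~~ low delta (sgn F sbd) (W b) (W d) -> ~~ low delta (sgn F scd) (W c) (W d) ->
  exists va vb vc vd, [/\ [/\ va \in W a, vb \in W b, vc \in W c & vd \in W d],
    [/\ F va vb = sab, F va vc = sac & F va vd = sad], F vb vc = sbc, F vb vd = sbd & F vc vd = scd].
Proof.
move=> ab bc cd dk.
have hd i j s : (i < j)%N -> (j < k)%N -> ~~ low delta (sgn F s) (W i) (W j) ->
  hdense (scale delta (2 * k * i) ^+ 2) (scale delta (2 * k * i.+1)) (sgn F s) (W i) (W j).
  by move=> ij jk; case: (dec s ij jk) => // ->.
have ck := ltn_trans cd dk; have bk := ltn_trans bc ck; have ak := ltn_trans ab bk.
have ac := ltn_trans ab bc; have bd := ltn_trans bc cd; have ad := ltn_trans ac cd.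
move=> /(hd _ _ _ ab bk) hab /(hd _ _ _ ac ck) hac /(hd _ _ _ ad dk) had.
move=> /(hd _ _ _ bc ck) hbc /(hd _ _ _ bd dk) hbd /(hd _ _ _ cd dk) hcd.
have d1' : delta <= 1 by move: d1; lra.
have s0 l := scale_gt0 d0 l.
have s1 l : scale delta l <= 1/4 := le_trans (scale_le d0 d1' l) d1.
have sa l m : (l <= m)%N -> scale delta m <= scale delta l by apply: scale_anti.
have [|||va [vb [vc [vd [h1 [/eqP e1 /eqP e2 /eqP e3] /eqP e4 /eqP e5 /eqP e6]]]]] :=
  embed4 (s0 _) (s1 _) (s0 _) _ (s1 _) (s0 _) _ (s0 _) _ (s0 _) hab hac had hbc hbd hcd
    (W0 ak) (W0 bk) (W0 ck) (W0 dk).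
- by apply: sa; rewrite leq_mul2l ab orbT.
- by apply: sa; rewrite leq_mul2l leqnSn orbT.
- by apply: sa; rewrite leq_mul2l bc orbT.
by exists va, vb, vc, vd.
Qed.

Lemma not_both_low A B : (0 < #|A|)%N -> (0 < #|B|)%N ->
  ~~ low delta (sgn F true) A B || ~~ low delta (sgn F false) A B.
Proof.
move=> A0 B0; rewrite -negb_and; apply/negP => /andP[]; rewrite /low => h1 h2.
have := ecount_split F A B; have : 0 < #|A|%:R * #|B|%:R :> R by rewrite mulr_gt0// ltr0n.
set t := #|A|%:R * #|B|%:R in h1 h2 *.
have : delta * t <= 1/4 * t by rewrite ler_wpM2r// mulr_ge0.
move: h1 h2; lra.
Qed.

Hypothesis rule : forall a b c d va vb vc vd, (a < b)%N -> (b < c)%N -> (c < d)%N -> (d < k)%N ->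
  va \in W a -> vb \in W b -> vc \in W c -> vd \in W d ->
  F va vb -> F vb vc -> F vc vd -> F va vd -> F va vc /\ F vb vd.

(** If the non-edges of a diagonal were not low, [pattern4] would embed a 4-cycle of edges whose
    corresponding diagonal is a non-edge, against [rule]. *)
Lemma diag_low a b c d : (a < b)%N -> (b < c)%N -> (c < d)%N -> (d < k)%N ->
  ~~ low delta (sgn F true) (W a) (W b) -> ~~ low delta (sgn F true) (W b) (W c) ->
  ~~ low delta (sgn F true) (W c) (W d) -> ~~ low delta (sgn F true) (W a) (W d) ->
  low delta (sgn F false) (W a) (W c) && low delta (sgn F false) (W b) (W d).
Proof.
move=> ab bc cd dk Nab Nbc Ncd Nad.
have ck := ltn_trans cd dk; have bk := ltn_trans bc ck; have ak := ltn_trans ab bk.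
have pick i j : (i < k)%N -> (j < k)%N -> exists s, ~~ low delta (sgn F s) (W i) (W j).
  by move=> ik jk; have /orP[] := not_both_low (W0 ik) (W0 jk); [exists true|exists false].
apply/andP; split; apply/negPn/negP => h.
  (* The other diagonal may carry any sign that is not low. *)
  have [s hs] := pick b d bk dk.
  have [va [vb [vc [vd [[A B C D] [e1 e2 e3] e4 _ e6]]]]] := pattern4 ab bc cd dk Nab h Nad Nbc hs Ncd.
  by have [] := rule ab bc cd dk A B C D e1 e4 e6 e3; rewrite e2.
have [s hs] := pick a c ak ck.
have [va [vb [vc [vd [[A B C D] [e1 e2 e3] e4 e5 e6]]]]] := pattern4 ab bc cd dk Nab hs Nad Nbc h Ncd.
by have [] := rule ab bc cd dk A B C D e1 e4 e6 e3; rewrite e5.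
Qed.

Variables (G : rel V) (p mu : R).
Hypothesis Fsym : symmetric F.
Hypothesis Greg : forall i j, (i < k)%N -> (j < k)%N -> i != j ->
  `|ecount R G (W i) (W j) - p * (#|W i|%:R * #|W j|%:R)| <= delta * (#|W i|%:R * #|W j|%:R).
Hypotheses (mu0 : 0 <= mu) (mup : mu <= p / 3) (mu1 : mu <= 1 - p).

(** Up to 2 delta a pair costs at least mu * (1 - weight): a white pair costs p >= 3 mu, a black one
    1 - p >= mu, a gray one at least 0. There are k ^ 2 - k ordered pairs, of total weight at most
    2k, which gives the 3k. *)
Lemma cost_decided : mu * (k%:R ^+ 2 - 3 * k%:R) - 2 * delta * k%:R ^+ 2 <= cost R (xorr F G) k W.
Proof.
pose N : rel 'I_k := fun i j => ~~ low delta (sgn F true) (W i) (W j).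
pose B : rel 'I_k := fun i j => low delta (sgn F false) (W i) (W j).
have lowC b i j : low delta (sgn F b) (W i) (W j) = low delta (sgn F b) (W j) (W i).
  by rewrite /low ecountC ?[#|W i|%:R * _]mulrC// => x y; rewrite /sgn Fsym.
have Nsym : symmetric N by move=> i j; rewrite /N lowC.
have Bsym : symmetric B by move=> i j; rewrite /B lowC.
have dg (a b c d : 'I_k) : (a < b < c)%N -> (c < d)%N ->
    N a b -> N b c -> N c d -> N a d -> B a c && B b d.
  by move=> /andP[ab bc] cd; apply: diag_low.
have pair (i j : 'I_k) : j != i ->
    mu * (1 - cweight R N B i j) - 2 * delta <= dens R (xorr F G) (W i) (W j).
  move=> ji; rewrite /cweight eq_sym (negbTE ji).
  have t0 : 0 < #|W i|%:R * #|W j|%:R :> R by rewrite mulr_gt0// ltr0n W0.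
  have := Greg (ltn_ord i) (ltn_ord j); rewrite eq_sym => /(_ ji).
  have g1 := ecount_xor_ge F G (W i) (W j); have g2 := ecount_xor_ge' F G (W i) (W j).
  rewrite /dens ler_pdivlMr// /N /B /low; move: t0 g1 g2.
  set t := #|W i|%:R * #|W j|%:R; set eD := ecount R (xorr F G) _ _; set eG := ecount R G _ _.
  set e1 := ecount R _ _ _; set e2 := ecount R _ _ _ => t0 g1 g2 /ler_normlP[n1 n2].
  have m1 : mu * t <= p / 3 * t by rewrite ler_wpM2r// ltW.
  have m2 : mu * t <= (1 - p) * t by rewrite ler_wpM2r// ltW.
  have D0 : 0 <= eD by apply: ecount_ge0.
  have dt : 0 <= delta * t by rewrite mulr_ge0// ltW.
  case: ifP => [/negPn h|_]; [lra|case: ifP => h; lra].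
apply: (@le_trans _ _ (\sum_(i < k) \sum_(j < k | j != i) (mu * (1 - cweight R N B i j) - 2 * delta))).
  have sz (c : R) : \sum_(i < k) \sum_(j < k | j != i) c = c * (k%:R ^+ 2 - k%:R).
    rewrite (eq_bigr (fun=> c * (k%:R - 1))).
      by rewrite sumr_const card_ord -mulr_natl; ring.
    move=> i _; have : \sum_(j < k) c = c * k%:R by rewrite sumr_const card_ord mulr_natr.
    by rewrite (bigD1 i)//= => h; rewrite mulrBr -h; ring.
  have := cweight_sum R Nsym Bsym dg; set S := \sum_u _ => hS.
  have -> : \sum_(i < k) \sum_(j < k | j != i) (mu * (1 - cweight R N B i j) - 2 * delta) =
      (mu - 2 * delta) * (k%:R ^+ 2 - k%:R) - mu * S.
    rewrite -sz /S mulr_sumr -sumrB; apply: eq_bigr => i _.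
    rewrite [in X in _ - X](bigD1 i)//= {2}/cweight eqxx add0r mulr_sumr -sumrB.
    by apply: eq_bigr => j _; ring.
  have : mu * S <= mu * (2 * k%:R) by rewrite ler_wpM2l.
  have : 0 <= delta * k%:R by rewrite mulr_ge0// ltW.
  move=> *; lra.
by apply: ler_sum => i _; apply: ler_sum => j; apply: pair.
Qed.
End Pattern.
End Core.

(** Working inside a half of each cluster leaves a complement large enough for [nearmin_upper]; a
    third allows for rounding the half down. *)
Lemma half_subset (R : realFieldType) (V : finType) (S : {set V}) : (1 < #|S|)%N ->
  exists2 A : {set V}, A \subset S &
    1/3 * #|S|%:R <= #|A|%:R :> R /\ 1/3 * #|S|%:R <= #|S :\: A|%:R :> R.
Proof.
move=> S1; have [|A sA cA] := @subset_of_card V S #|S|./2; first by lia.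
exists A => //; have cD := cardsID A S; rewrite (setIidPr sA) in cD.
have h1 : (#|S| <= 3 * #|A|)%N by lia.
have h2 : (#|S| <= 3 * #|S :\: A|)%N by lia.
by move: h1 h2; rewrite -2!(ler_nat R) 2!natrM; split; lra.
Qed.

(** Descend to a near-minimal cylinder W1, halve its sets and decide all pairs to get W2. Then
    [cost_decided] bounds the cost of W2 from below, while it exceeds that of W1, hence that of W,
    by at most delta. *)
Lemma cylinder_cost (R : realType) (k : nat) (p delta mu : R) :
  0 < delta -> delta <= 1/4 -> 0 <= mu -> mu <= p / 3 -> mu <= 1 - p ->
  exists2 eta : R, 0 < eta &
  forall (V : finType) (F G : rel V) (W : nat -> {set V}), symmetric F ->
  (forall a b c d va vb vc vd, (a < b)%N -> (b < c)%N -> (c < d)%N -> (d < k)%N ->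
    va \in W a -> vb \in W b -> vc \in W c -> vd \in W d ->
    F va vb -> F vb vc -> F vc vd -> F va vd -> F va vc /\ F vb vd) ->
  (forall i, (i < k)%N -> 2 <= eta * #|W i|%:R) ->
  (forall i j (A B : {set V}), (i < k)%N -> (j < k)%N -> i != j -> A \subset W i -> B \subset W j ->
    eta * #|W i|%:R <= #|A|%:R -> eta * #|W j|%:R <= #|B|%:R ->
    `|ecount R G A B - p * (#|A|%:R * #|B|%:R)| <= delta * (#|A|%:R * #|B|%:R)) ->
  mu * (k%:R ^+ 2 - 3 * k%:R) - 2 * delta * k%:R ^+ 2 - delta <= cost R (xorr F G) k W.
Proof.
move=> d0 d1 mu0 mup mu1.
have d1' : delta <= 1 by lra.
set z0 := scale delta (2 * k * k).
have z00 : 0 < z0 := scale_gt0 d0 _.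
have z01 : z0 <= 1 := scale_le1 d0 d1' _.
(* The proportion kept from W1 to W2; [kappa] makes the error in [nearmin_upper] exactly delta, and
   N steps suffice for the descent since the cost is at most k ^ 2. *)
pose z := z0 * (1/3).
have zz0 : 0 < z by rewrite mulr_gt0//; lra.
have z1 : z <= 1/3 by rewrite /z; lra.
pose e := (2 / z) ^+ k.
have e0 : 0 < e by rewrite exprn_gt0// divr_gt0.
pose kappa := delta / e.
have kap0 : 0 < kappa by rewrite divr_gt0.
pose N := (Num.truncn (k%:R ^+ 2 / kappa)).+1.
have NP : k%:R ^+ 2 < N%:R * kappa.
  by rewrite -ltr_pdivrMr// /N truncnS_gt.
(* The proportion kept from W to W2: z ^ N in the descent, then z. *)
exists (z * z ^+ N); first by rewrite mulr_gt0// exprn_gt0.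
move=> V F G W Fsym rule szW reg.
have z1' : z <= 1 by lra.
have [W1 [s1 c1 nm]] :=
  descent (ltW zz0) z1' (ltW kap0) (le_lt_trans (cost_le R (xorr F G) k W) NP).
have W1big i : (i < k)%N -> (1 < #|W1 i|)%N.
  move=> ik; rewrite -(ler_nat R); have [_] := s1 i; apply: le_trans.
  apply: le_trans (szW i ik) _; rewrite ler_wpM2r// ler_piMl// exprn_ge0// ltW//.
have exH i : exists A : {set V}, [/\ A \subset W1 i,
    1/3 * #|W1 i|%:R <= #|A|%:R :> R & (i < k)%N -> 1/3 * #|W1 i|%:R <= #|W1 i :\: A|%:R :> R].
  have [ik|ik] := ltnP i k; last first.
    by exists (W1 i); split => //; have : 0 <= #|W1 i|%:R :> R by []; lra.
  by have [A sA [cA cD]] := half_subset R (W1big i ik); exists A.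
have [H hH] := choice exH.
have sH : subcyl (1/3 : R) H W1 by move=> i; have [] := hH i.
have [W2 s2 dec] := decide_pairs k F H d0 d1' (lexx _).
have s21 : subcyl z W2 W1 by apply: subcyl_trans s2 sH; apply: ltW.
have pos1 i : (i < k)%N -> (0 < #|W1 i|)%N by move/W1big/ltnW.
have pos2 i : (i < k)%N -> (0 < #|W2 i|)%N.
  move=> ik; rewrite -(ltr_nat R); have [_] := s21 i; apply: lt_le_trans.
  by rewrite mulr_gt0// ltr0n pos1.
have up : cost R (xorr F G) k W2 <= cost R (xorr F G) k W1 + kappa * e.
  apply: nearmin_upper nm s21 _ pos1 => //; first exact: ltW.
  move=> i ik; have [_ _ /(_ ik) h] := hH i; have [s2i _] := s2 i.
  apply: (@le_trans _ _ #|W1 i :\: H i|%:R).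
    by apply: le_trans h; rewrite ler_wpM2r.
  by rewrite ler_nat subset_leq_card// setDS.
have sW i : W2 i \subset W i.
  by have [a _] := s21 i; have [b _] := s1 i; apply: fintype.subset_trans a b.
have low2 : mu * (k%:R ^+ 2 - 3 * k%:R) - 2 * delta * k%:R ^+ 2 <= cost R (xorr F G) k W2.
  apply: (cost_decided d0 d1 pos2 dec _ Fsym (p := p)) => //.
  - move=> a b c d va vb vc vd ab bc cd dk A B C D.
    apply: (rule a b c d) => //; apply: (fintype.subsetP (sW _)) => //.
  - move=> i j ik jk ij; apply: (reg i j) => //.
      by have [_] := subcyl_trans (ltW zz0) s21 s1 i.
    by have [_] := subcyl_trans (ltW zz0) s21 s1 j.
have ke : kappa * e = delta by rewrite /kappa divfK// gt_eqF.
move: up; rewrite ke; lra.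
Qed.

(** * An explicit quasirandom graph *)

(** Cauchy-Schwarz against the constant 1, from the nonnegative sum of the (n g_i - s) ^ 2. *)
Lemma sqr_sum_le (R : realFieldType) (I : finType) (A : {set I}) (g : I -> R) :
  (\sum_(i in A) g i) ^+ 2 <= #|A|%:R * \sum_(i in A) g i ^+ 2.
Proof.
set s := \sum_(i in A) g i; set n : R := #|A|%:R.
have [eA|nA] := eqVneq A set0; first by rewrite /s /n eA !big_set0 mulr0 expr0n.
have n0 : 0 < n by rewrite ltr0n card_gt0.
have : 0 <= \sum_(i in A) (n * g i - s) ^+ 2 by apply: sumr_ge0 => i _; apply: sqr_ge0.
have -> : \sum_(i in A) (n * g i - s) ^+ 2 = n * (n * \sum_(i in A) g i ^+ 2 - s ^+ 2).
  transitivity (\sum_(i in A) (n ^+ 2 * g i ^+ 2 - 2 * n * s * g i + s ^+ 2)).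
    by apply: eq_bigr => i _; ring.
  rewrite big_split sumrB /= -!mulr_sumr sumr_const -/s -mulr_natl -/n; ring.
by rewrite pmulr_rge0// subr_ge0.
Qed.

Section Blowup.
Variables (R : realFieldType) (K : finFieldType) (Z : {set K}) (V : finType) (lab : V -> K * K).
Local Notation q := (#|K|%:R : R).

(* Two vertices are adjacent when ac + b + d lies in Z. As (a' - a)c runs over the whole field
   with c, two centred rows with distinct first labels are orthogonal. *)
Definition labrel (l l' : K * K) : bool := l.1 * l'.1 + l.2 + l'.2 \in Z.

Definition centred (z : K) : R := (z \in Z)%:R - #|Z|%:R / q.

Lemma labrel_sym : symmetric labrel.
Proof. by move=> l l'; rewrite /labrel mulrC addrAC. Qed.

Lemma card_gt0R : 0 < q.
Proof. by rewrite ltr0n; apply/card_gt0P; exists 0. Qed.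

Lemma sum_centred : \sum_z centred z = 0.
Proof.
rewrite sumrB sumr_const -[X in _ - X]mulr_natr divfK ?gt_eqF ?card_gt0R//.
rewrite -natr_sum -sum1_card [in X in _ - X]big_mkcond /=.
by apply/eqP; rewrite subr_eq0; apply/eqP; congr _%:R; apply: eq_bigr => z _; case: (z \in Z).
Qed.

Lemma centred_bound z : `|centred z| <= 1.
Proof.
have h0 : 0 <= #|Z|%:R / q by rewrite divr_ge0.
have h1 : #|Z|%:R / q <= 1 by rewrite ler_pdivrMr ?card_gt0R// mul1r ler_nat max_card.
by rewrite /centred; case: (z \in Z) => /=; rewrite ler_norml; apply/andP; split; move: h0 h1; set t := _ / _; lra.
Qed.

Definition cmat (l l' : K * K) : R := centred (l.1 * l'.1 + l.2 + l'.2).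

Lemma cmat_orth l l' : l.1 != l'.1 -> \sum_m cmat m l * cmat m l' = 0.
Proof.
case: l l' => [a b] [a' b'] /= aa.
rewrite -(pair_bigA _ (fun c d => cmat (c, d) (a, b) * cmat (c, d) (a', b'))) /=.
transitivity (\sum_c \sum_d centred d * centred (d + (c * (a' - a) + (b' - b)))).
  (* Translating d frees the first factor of c, so the sum over c acts on the second factor only. *)
  apply: eq_bigr => c _; rewrite (reindex_inj (addIr (- (c * a + b)))) /=.
  by apply: eq_bigr => d _; rewrite /cmat /=; congr (centred _ * centred _); ring.
rewrite exchange_big /=; apply: big1 => d _; rewrite -mulr_sumr.
have inj : injective (fun c : K => d + (c * (a' - a) + (b' - b))).
  by move=> c c' /addrI /addIr /mulIf; apply; rewrite subr_eq0 eq_sym.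
have -> : \sum_c centred (d + (c * (a' - a) + (b' - b))) = 0.
  rewrite -[RHS]sum_centred; apply/esym; exact: (reindex_inj inj).
by rewrite mulr0.
Qed.

Variable S : R.
Hypothesis fib : forall l, #|[set x | lab x == l]|%:R <= S.

Lemma fib1 c : #|[set x | (lab x).1 == c]|%:R <= q * S.
Proof.
have -> : #|[set x | (lab x).1 == c]|%:R = \sum_d #|[set x | lab x == (c, d)]|%:R :> R.
  rewrite -natr_sum; congr _%:R; rewrite -sum1_card.
  under [RHS]eq_bigr do rewrite -sum1_card.
  rewrite (partition_big (fun x => (lab x).2) predT) //=; apply: eq_bigr => d _.
  by apply: eq_bigl => x; rewrite !inE; case: (lab x).
by rewrite mulr_natl -sumr_const; apply: ler_sum.
Qed.

(** Cauchy-Schwarz over A, then passage from vertices to all labels at a factor S. In the expanded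
    square, pairs y, y' with distinct first labels cancel by orthogonality; at most |V| q S pairs
    remain, each contributing at most q ^ 2. *)
Lemma blowup_disc (A B : {set V}) :
  (\sum_(x in A) \sum_(y in B) cmat (lab x) (lab y)) ^+ 2 <=
    #|V|%:R ^+ 2 * S ^+ 2 * q ^+ 3.
Proof.
have S0 : 0 <= S by apply: le_trans (fib (0, 0)).
have q0 := card_gt0R.
apply: le_trans (sqr_sum_le _ _) _.
set g := fun l => \sum_(y in B) cmat l (lab y).
have g0 l : 0 <= g l ^+ 2 by apply: sqr_ge0.
have h1 : \sum_(x in A) g (lab x) ^+ 2 <= S * \sum_l g l ^+ 2.
  apply: (@le_trans _ _ (\sum_x g (lab x) ^+ 2)).
    by rewrite big_mkcond; apply: ler_sum => x _; case: ifP.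
  rewrite (partition_big lab predT) //= mulr_sumr; apply: ler_sum => l _.
  rewrite (eq_bigr (fun=> g l ^+ 2)); last by move=> x /eqP ->.
  rewrite (eq_bigl (fun x => x \in [set x | lab x == l])); last by move=> x; rewrite inE.
  by rewrite sumr_const -mulr_natl ler_wpM2r.
have h2 : \sum_l g l ^+ 2 <= #|V|%:R * (q * S) * q ^+ 2.
  have -> : \sum_l g l ^+ 2 = \sum_(y in B) \sum_(y' in B) \sum_l cmat l (lab y) * cmat l (lab y').
    transitivity (\sum_l \sum_(y in B) \sum_(y' in B) cmat l (lab y) * cmat l (lab y')).
      by apply: eq_bigr => l _; rewrite expr2 mulr_suml; apply: eq_bigr => y _; rewrite mulr_sumr.
    by rewrite exchange_big; apply: eq_bigr => y _; rewrite exchange_big.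
  apply: (@le_trans _ _ (\sum_(y : V) \sum_(y' in [set y' | (lab y').1 == (lab y).1]) q ^+ 2)).
    rewrite big_mkcond; apply: ler_sum => y _; case: ifP => _; last first.
      by apply: sumr_ge0 => y' _; apply: sqr_ge0.
    rewrite big_mkcond [leRHS]big_mkcond; apply: ler_sum => y' _; rewrite inE.
    case: eqVneq => [e|ne]; last by rewrite cmat_orth 1?eq_sym//; case: ifP.
    case: ifP => _; last exact: sqr_ge0.
    apply: (@le_trans _ _ (\sum_(l : K * K) 1)); last first.
      by rewrite sumr_const card_prod natrM expr2.
    apply: ler_sum => l _; apply: le_trans (ler_norm _) _; rewrite normrM.
    by apply: mulr_ile1; rewrite ?normr_ge0 ?centred_bound.
  rewrite -mulrA [leRHS]mulr_natl -[leRHS]sumr_const; apply: ler_sum => y _.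
  by rewrite sumr_const -[leLHS]mulr_natl ler_wpM2r ?sqr_ge0// fib1.
apply: (@le_trans _ _ (#|V|%:R * (S * (#|V|%:R * (q * S) * q ^+ 2)))).
  apply: ler_pM => //.
  - by apply: sumr_ge0 => x _; apply: g0.
  - by rewrite ler_nat max_card.
  - by apply: le_trans h1 _; rewrite ler_wpM2l.
by rewrite le_eqVlt; apply/orP; left; apply/eqP; ring.
Qed.
End Blowup.

Lemma ecount_labrel (R : realFieldType) (K : finFieldType) (Z : {set K}) (V : finType)
    (lab : V -> K * K) (A B : {set V}) :
  ecount R (fun x y => labrel Z (lab x) (lab y)) A B =
  \sum_(x in A) \sum_(y in B) cmat R Z (lab x) (lab y) + #|Z|%:R / #|K|%:R * (#|A|%:R * #|B|%:R).
Proof.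
set c := #|Z|%:R / _.
transitivity (\sum_(x in A) \sum_(y in B) (cmat R Z (lab x) (lab y) + c)).
  by apply: eq_bigr => x _; apply: eq_bigr => y _; rewrite /cmat /centred subrK.
under eq_bigr do rewrite big_split sumr_const.
by rewrite big_split sumr_const /= -mulrnA -[c *+ _]mulr_natr natrM [#|B|%:R * _]mulrC.
Qed.

(** Labels are dealt out cyclically, so that the fibres are balanced. *)
Definition mod_label (L : finType) (l0 : L) n (x : 'I_n) : L := nth l0 (enum L) (x %% #|L|).

Lemma mod_label_fiber (L : finType) (l0 l : L) n :
  (#|[set x : 'I_n | mod_label l0 x == l]| <= (n %/ #|L|).+1)%N.
Proof.
have L0 : (0 < #|L|)%N by apply/card_gt0P; exists l0.
pose f (x : 'I_n) : 'I_(n %/ #|L|).+1 := inord (x %/ #|L|).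
rewrite -[leqRHS]card_ord -(card_in_imset (f := f)); first exact: max_card.
move=> x y; rewrite !inE => /eqP hx /eqP hy /(congr1 val).
have le (z : 'I_n) : (z %/ #|L| < (n %/ #|L|).+1)%N.
  by rewrite ltnS leq_div2r// ltnW.
rewrite /= !inordK// => e; apply: val_inj => /=.
rewrite (divn_eq x #|L|) (divn_eq y #|L|) e; congr (_ + _)%N.
apply/eqP; rewrite -(nth_uniq l0 _ _ (enum_uniq L)) -?cardE ?ltn_mod//.
by move: hx hy; rewrite /mod_label => -> ->.
Qed.

Lemma quasirandom (R : realType) (p eps : R) : 0 <= p -> p <= 1 -> 0 < eps ->
  exists N, forall n, (N <= n)%N -> exists2 g : rel 'I_n, symmetric g &
    forall A B, `|ecount R g A B - p * (#|A|%:R * #|B|%:R)| <= eps * n%:R ^+ 2.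
Proof.
move=> p0 p1 e0.
(* The first term keeps the discrepancy, at most 2 n ^ 2 / sqrt q, below eps / 2 * n ^ 2; the second
   does the same for the error 1 / q in approximating p by m / q. *)
pose b := (Num.truncn (16 / eps ^+ 2 + 2 / eps)).+1.
have [q bq q_pr] := prime_above b.
have cq : #|{: 'F_q}| = q by rewrite card_Fp.
have q0 : 0 < q%:R :> R by rewrite ltr0n prime_gt0.
have qbig : 16 / eps ^+ 2 + 2 / eps <= q%:R :> R.
  apply: ltW; apply: lt_le_trans (_ : b%:R <= _); first exact: truncnS_gt.
  by rewrite ler_nat ltnW.
have eps1 : 0 <= 16 / eps ^+ 2 by rewrite divr_ge0 ?sqr_ge0.
have eps2 : 0 <= 2 / eps by rewrite divr_ge0// ltW.
have q1 : 16 <= eps ^+ 2 * q%:R by rewrite -ler_pdivrMl ?exprn_gt0// mulrC; lra.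
have q2 : 2 <= eps * q%:R by rewrite -ler_pdivrMl// mulrC; lra.
pose m := Num.truncn (p * q%:R).
have pq0 : 0 <= p * q%:R by rewrite mulr_ge0// ltW.
have /andP[m1 m2] : m%:R <= p * q%:R < m.+1%:R by rewrite /m truncn_itv.
have mq : (m <= #|[set: 'F_q]|)%N.
  by rewrite cardsT cq -(ler_nat R); apply: le_trans m1 _; rewrite ler_piMl// ltW.
have [Z _ cZ] := subset_of_card mq.
exists (q * q)%N => n nq.
pose lab := @mod_label ('F_q * 'F_q)%type (0, 0) n.
exists (fun x y => labrel Z (lab x) (lab y)); first by move=> x y; rewrite labrel_sym.
move=> A B; rewrite ecount_labrel cZ cq.
set D := \sum_(x in A) _; set t := #|A|%:R * #|B|%:R.
have n0 : 0 <= n%:R :> R by [].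
have t0 : 0 <= t by rewrite mulr_ge0.
have tn : t <= n%:R ^+ 2.
  by rewrite expr2; apply: ler_pM => //; rewrite ler_nat -[leqRHS]card_ord max_card.
have q20 : 0 < q%:R ^+ 2 :> R by rewrite exprn_gt0.
(* The factor 2 covers the rounding of n / q ^ 2, since n >= q ^ 2. *)
pose S : R := 2 * n%:R / q%:R ^+ 2.
have fib l : #|[set x | lab x == l]|%:R <= S.
  rewrite /S ler_pdivlMr//.
  have := mod_label_fiber (0, 0) l n; rewrite -/lab card_prod cq.
  have := leq_trunc_div n (q * q); set u := (n %/ _)%N; set v := #|_| => h1 h2.
  have : (v * (q * q) <= u.+1 * (q * q))%N by rewrite leq_mul2r h2 orbT.
  rewrite mulSn => h3; have : (v * (q * q) <= 2 * n)%N.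
    by rewrite mul2n -addnn; apply: leq_trans h3 _; apply: leq_add.
  by rewrite -(ler_nat R) !natrM expr2.
have hD : D ^+ 2 <= (eps / 2 * n%:R ^+ 2) ^+ 2.
  apply: le_trans (blowup_disc Z fib A B) _; rewrite card_ord cq.
  have -> : n%:R ^+ 2 * S ^+ 2 * q%:R ^+ 3 = 4 / q%:R * (n%:R ^+ 2) ^+ 2.
    by rewrite /S; field; rewrite gt_eqF.
  rewrite [leRHS]exprMn; apply: ler_wpM2r; first exact: sqr_ge0.
  rewrite ler_pdivrMr//.
  by rewrite expr_div_n (_ : 2 ^+ 2 = 4)//; [lra|ring].
have {}hD : `|D| <= eps / 2 * n%:R ^+ 2.
  rewrite -(ler_pXn2r (n := 2))// ?nnegrE ?normr_ge0 ?real_normK ?num_real//.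
  by rewrite mulr_ge0 ?sqr_ge0// divr_ge0// ltW.
have hm : `|m%:R / q%:R - p| <= eps / 2.
  have h1 : m%:R / q%:R <= p by rewrite ler_pdivrMr.
  have h2 : p <= m%:R / q%:R + 1 / q%:R.
    by rewrite -mulrDl ler_pdivlMr//; move: m2; rewrite -natr1; lra.
  have h3 : 1 / q%:R <= eps / 2 by rewrite ler_pdivrMr//; lra.
  by rewrite ler_norml; apply/andP; split; lra.
have -> : D + m%:R / q%:R * t - p * t = D + (m%:R / q%:R - p) * t by ring.
apply: le_trans (ler_normD _ _) _; rewrite normrM (ger0_norm t0).
have : `|m%:R / q%:R - p| * t <= eps / 2 * n%:R ^+ 2 by apply: ler_pM.
lra.
Qed.

(** * The two bounds *)

Section Graphs.
Variable n : nat.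
Implicit Types (E F : {set {set 'I_n}}).

Lemma word_representable_order F : word_representable F ->
  exists2 idx : 'I_n -> nat, injective idx &
    forall a b c d, (idx a < idx b)%N -> (idx b < idx c)%N -> (idx c < idx d)%N ->
      [set a; b] \in F -> [set b; c] \in F -> [set c; d] \in F -> [set a; d] \in F ->
      [set a; c] \in F /\ [set b; d] \in F.
Proof.
move=> [_ [w [wall rep]]]; exists (fun x => index x w).
  by move=> x y e; rewrite -(nth_index x (wall x)) e (nth_index x (wall y)).
have lead x y : (index x w < index y w)%N -> [set x; y] \in F <-> leads w x y.
  move=> xy; have ne : x != y by apply: contraTneq xy => ->; rewrite ltnn.
  by rewrite (rep _ _ ne) /alternate; apply: sorted_leads.
move=> a b c d ab bc cd /(lead _ _ ab) lab /(lead _ _ bc) lbc /(lead _ _ cd) lcd.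
have bd := ltn_trans bc cd; have ac := ltn_trans ab bc; have ad := ltn_trans ac cd.
move=> /(lead _ _ ad) lad; have [lac lbd] := leads_diag lab lbc lcd lad.
by split; [apply/(lead _ _ ac)|apply/(lead _ _ bd)].
Qed.

Lemma interval_blocks (idx : 'I_n -> nat) k s : injective idx -> (k * s <= n)%N ->
  exists W : nat -> {set 'I_n}, (forall i, (i < k)%N -> #|W i| = s) /\
    forall i j x y, (i < j)%N -> x \in W i -> y \in W j -> (idx x < idx y)%N.
Proof.
move=> inj ksn; pose u := sort (relpre idx leq) (enum 'I_n).
have uu : uniq u by rewrite sort_uniq enum_uniq.
have szu : size u = n by rewrite size_sort size_enum_ord.
have su : sorted (relpre idx leq) u.
  by apply: sort_sorted => x y /=; apply: leq_total.
exists (fun i => [set x in take s (drop (i * s) u)]); split.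
  move=> i ik; rewrite cardsE; have /card_uniqP -> : uniq (take s (drop (i * s) u)).
    by rewrite take_uniq ?drop_uniq.
  rewrite size_takel// size_drop szu leq_subRL.
    by apply: leq_trans ksn; rewrite addnC -mulSn leq_mul2r ik orbT.
  by apply: leq_trans ksn; rewrite leq_mul2r ltnW ?orbT.
have memW i x : x \in take s (drop (i * s) u) -> x \in u /\ (i * s <= index x u < i.+1 * s)%N.
  move=> xW; have xu : x \in u by apply: mem_drop (mem_take xW).
  split=> //; have s0 : (0 < s)%N by case: (s) xW; rewrite ?take0.
  have /(nthP x) [m ms e] := xW; rewrite nth_take in e; last first.
    by apply: leq_trans ms _; rewrite size_take; case: ltnP => // /ltnW.
  have ms' : (m < s)%N by apply: leq_trans ms _; rewrite size_take; case: ltnP => // /ltnW.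
  rewrite nth_drop in e.
  have lt : (i * s + m < size u)%N.
    rewrite -ltn_subRL -size_drop; apply: leq_trans ms _.
    by rewrite size_take; case: ltnP => // /ltnW.
  by rewrite -e index_uniq// leq_addr mulSn addnC ltn_add2r.
move=> i j x y ij; rewrite !inE => /memW[xu /andP[_ x2]] /memW[yu /andP[y1 _]].
have lt : (index x u < index y u)%N.
  by apply: leq_trans x2 (leq_trans _ y1); rewrite leq_mul2r ij orbT.
have tr : transitive (relpre idx leq) by move=> a b c /=; apply: leq_trans.
have := sorted_ltn_index tr su; move/(_ x y xu yu lt) => /=.
rewrite leq_eqVlt => /orP[/eqP/inj e|//]; by rewrite e ltnn in lt.
Qed.

Lemma pair_cardE (e : {set 'I_n}) : #|e| = 2%N ->
  (\sum_x \sum_(y | y != x) ([set x; y] == e) = 2)%N.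
Proof.
move=> /eqP/cards2P[a [b [ab ->]]]; rewrite pair_big_dep /= -big_mkcondr /=.
rewrite sum1_card (_ : #|_| = #|[set (a, b); (b, a)]|).
  by rewrite cards2; have -> : (a, b) != (b, a) by rewrite xpair_eqE negb_and ab.
apply: eq_card => -[x y]; rewrite !inE unfold_in /= !xpair_eqE; apply/andP/orP.
  case=> yx /eqP exy.
  have : x \in [set a; b] by rewrite -exy !inE eqxx.
  have : y \in [set a; b] by rewrite -exy !inE eqxx orbT.
  by rewrite !inE => /orP[] /eqP ? /orP[] /eqP ?; subst; rewrite ?eqxx in yx *; [|right|left|].
by case=> /andP[/eqP-> /eqP->]; rewrite ?ab ?[_ == a]eq_sym ?ab; split => //; rewrite setUC.
Qed.

Lemma handshake E : is_graph E -> (\sum_x \sum_(y | y != x) ([set x; y] \in E) = 2 * #|E|)%N.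
Proof.
move=> /forall_inP gE.
transitivity (\sum_x \sum_(y | y != x) \sum_(e in E) ([set x; y] == e))%N.
  apply: eq_bigr => x _; apply: eq_bigr => y _; have [h|h] := boolP (_ \in E).
    rewrite (bigD1 [set x; y])//= eqxx big1// => e /andP[_ ne].
    by rewrite eq_sym (negbTE ne).
  by rewrite big1// => e eE; case: eqP => // e'; rewrite e' eE in h.
under eq_bigr do rewrite exchange_big.
rewrite exchange_big /= -sum1_card big_distrr /=; apply: eq_bigr => e eE.
by rewrite pair_cardE//; apply/eqP/gE.
Qed.
End Graphs.

Section BlockSum.
Variables (R : realType) (V : finType) (X : rel V) (k : nat) (W : nat -> {set V}).
Hypothesis disj : forall i j x, (i < k)%N -> (j < k)%N -> x \in W i -> x \in W j -> i = j.

Lemma block_sum_le (P : pred 'I_k) (f : V -> R) (Q : pred V) : (forall x, 0 <= f x) ->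
  (forall i x, P i -> x \in W i -> Q x) ->
  \sum_(i < k | P i) \sum_(x in W i) f x <= \sum_(x | Q x) f x.
Proof.
move=> f0 PQ; rewrite (exchange_big_dep Q) /=; last by move=> i x; apply: PQ.
apply: ler_sum => x _; have [i /andP[Pi xi]|none] := pickP (fun i : 'I_k => P i && (x \in W i)).
  rewrite (bigD1 i) ?Pi//= big1 ?addr0// => j /andP[/andP[_ xj]].
  by rewrite -val_eqE /= (disj (ltn_ord j) (ltn_ord i) xj xi) eqxx.
by rewrite big_pred0.
Qed.

Lemma block_pairs_le :
  \sum_(i < k) \sum_(j < k | j != i) ecount R X (W i) (W j) <=
  \sum_x \sum_(y | y != x) (X x y)%:R.
Proof.
apply: (@le_trans _ _ (\sum_(i < k) \sum_(x in W i) \sum_(y | y != x) (X x y)%:R)); last first.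
  by apply: block_sum_le => // x; apply: sumr_ge0.
apply: ler_sum => i _; rewrite /ecount exchange_big /=; apply: ler_sum => x xi.
apply: block_sum_le => // j y ji yj; apply: contraNneq ji => e; rewrite e in yj.
by apply/eqP/val_inj; apply: disj yj xi.
Qed.
End BlockSum.

Definition symdiff (T : finType) (A B : {set T}) := (A :\: B) :|: (B :\: A).

Lemma in_symdiff (T : finType) (A B : {set T}) x : (x \in symdiff A B) = ((x \in B) != (x \in A)).
Proof. by rewrite !inE; case: (x \in A); case: (x \in B). Qed.

Lemma symdiff_graph n (E F : {set {set 'I_n}}) : is_graph E -> is_graph F -> is_graph (symdiff E F).
Proof.
move=> /forall_inP gE /forall_inP gF; apply/forall_inP => e.
by rewrite !inE => /orP[/andP[_ /gE]|/andP[_ /gF]].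
Qed.

Lemma symdiff_triangle (T : finType) (A B C : {set T}) :
  (#|symdiff A C| <= #|symdiff A B| + #|symdiff B C|)%N.
Proof.
apply: leq_trans (leq_card_setU _ _).1; apply/subset_leq_card/fintype.subsetP => x.
by rewrite in_symdiff in_setU !in_symdiff; case: (x \in A); case: (x \in B); case: (x \in C).
Qed.

(** * Distance of quasirandom graphs from word-representable ones *)

Section Lower.
Variable R : realType.

(** Error budget: the 3k term and the delta terms take eps / 8 of k ^ 2 each, and rounding n down to
    s k loses at most 2 k n <= eps / 4 * n ^ 2. *)
Lemma block_bound (eps mu delta k s n : R) : 0 < eps -> 0 <= mu -> mu <= 1 -> 1 <= k ->
  24 <= eps * k -> 0 <= delta -> 24 * delta <= eps -> 0 <= s -> s * k <= n -> n <= s * k + k ->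
  8 * k <= eps * n ->
  n ^+ 2 * (mu - eps) <= s ^+ 2 * (mu * (k ^+ 2 - 3 * k) - 2 * delta * k ^+ 2 - delta).
Proof.
move=> e0 mu0 mu1 k1 ek d0 de s0 skn nsk kn.
have k0 : 0 <= k by lra.
have n0 : 0 <= n by apply: le_trans skn; apply: mulr_ge0.
have s2 : 0 <= s ^+ 2 by apply: sqr_ge0.
have h1 : k ^+ 2 * (mu - eps / 4) <= mu * (k ^+ 2 - 3 * k) - 2 * delta * k ^+ 2 - delta.
  have a1 : 24 * k <= eps * k ^+ 2 by rewrite expr2 mulrA ler_wpM2r.
  have a2 : mu * k <= k by rewrite ler_piMl.
  have a3 : delta <= delta * k ^+ 2 by rewrite ler_peMr// exprn_ege1.
  have a4 : 24 * delta * k ^+ 2 <= eps * k ^+ 2 by rewrite ler_wpM2r// sqr_ge0.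
  by lra.
apply: le_trans (ler_wpM2l s2 h1).
rewrite mulrA -exprMn; set t := s * k in skn nsk *.
have t0 : 0 <= t by apply: mulr_ge0.
have tn2 : t ^+ 2 <= n ^+ 2 by apply: lerXn2r; rewrite ?nnegrE.
have nt2 : n ^+ 2 - 2 * k * n <= t ^+ 2.
  have : (n - k) * n <= t * n by rewrite ler_wpM2r//; lra.
  have [nk|nk] := leP k n.
    have : (n - k) * (n - k) <= t * t by apply: ler_pM; lra.
    have := sqr_ge0 k; rewrite !expr2; lra.
  have : n * n <= k * n by rewrite ler_wpM2r// ltW.
  have := sqr_ge0 t; rewrite !expr2; lra.
have b1 : 8 * k * n <= eps * n * n by rewrite ler_wpM2r.
have b2 : mu * (n ^+ 2 - 2 * k * n) <= mu * t ^+ 2 by rewrite ler_wpM2l.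
have b3 : eps * t ^+ 2 <= eps * n ^+ 2 by rewrite ler_wpM2l// ltW.
have b4 : mu * (k * n) <= k * n by rewrite ler_piMl// mulr_ge0.
have b5 : 0 <= eps * n ^+ 2 by rewrite mulr_ge0 ?sqr_ge0// ltW.
move: b1 b2 b3 b4 b5; rewrite !expr2; lra.
Qed.

Lemma quasirandom_far (p mu eps : R) : 0 <= mu -> mu <= p / 3 -> mu <= 1 - p -> 0 < eps ->
  exists2 eps' : R, 0 < eps' & exists N, forall n, (N <= n)%N -> forall g : rel 'I_n,
    symmetric g -> (forall A B, `|ecount R g A B - p * (#|A|%:R * #|B|%:R)| <= eps' * n%:R ^+ 2) ->
    forall E F : {set {set 'I_n}}, is_graph E ->
      (forall x y, x != y -> ([set x; y] \in E) = g x y) -> word_representable F ->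
      n%:R ^+ 2 * (mu - eps) <= 2 * #|symdiff E F|%:R.
Proof.
move=> mu0 mup mu1 e0.
pose k := (Num.truncn (24 / eps)).+1.
have k1 : 1 <= k%:R :> R by rewrite ler1n.
have k0 : 0 < k%:R :> R by rewrite ltr0n.
have ek : 24 <= eps * k%:R.
  by rewrite mulrC -ler_pdivrMr// ltW// truncnS_gt.
pose delta := Num.min (1/4) (eps / 24).
have d0 : 0 < delta by rewrite lt_min; apply/andP; split; lra.
have d1 : delta <= 1/4 by rewrite ge_min lexx.
have de : 24 * delta <= eps.
  have : delta <= eps / 24 by rewrite ge_min lexx orbT.
  lra.
have [eta eta0 core] := @cylinder_cost R k p delta mu d0 d1 mu0 mup mu1.
(* Chosen so that eps' n ^ 2 <= delta |A| |B| when |A|, |B| >= eta s, given n <= 2 k s. *)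
pose eps' := delta * eta ^+ 2 / (4 * k%:R ^+ 2).
have eps'0 : 0 < eps' by rewrite /eps' divr_gt0 ?mulr_gt0 ?exprn_gt0.
exists eps' => //.
(* The terms ensure, in order, the rounding condition of [block_bound], eta s >= 2, and n <= 2 k
   s. *)
pose b := 8 * k%:R / eps + 4 * k%:R / eta + 2 * k%:R.
exists (Num.truncn b).+1 => n nN g gsym disc E F gE EG wrF.
have bn : b <= n%:R by apply: ltW; apply: lt_le_trans (truncnS_gt b) _; rewrite ler_nat.
have b1 : 0 <= 8 * k%:R / eps by rewrite divr_ge0 ?mulr_ge0// ltW.
have b2 : 0 <= 4 * k%:R / eta by rewrite divr_ge0 ?mulr_ge0// ltW.
have n1 : 8 * k%:R <= eps * n%:R.
  by rewrite -ler_pdivrMl// mulrC; move: bn b1 b2 k1; rewrite /b; lra.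
have n2 : 4 * k%:R <= eta * n%:R.
  by rewrite -ler_pdivrMl// mulrC; move: bn b1 b2 k1; rewrite /b; lra.
have n3 : 2 * k%:R <= n%:R :> R.
  by apply: le_trans bn; rewrite /b lerDr addr_ge0.
have kN : (0 < k)%N by [].
pose s := (n %/ k)%N.
have skn : s%:R * k%:R <= n%:R :> R by rewrite -natrM ler_nat leq_trunc_div.
have nsk : n%:R <= s%:R * k%:R + k%:R :> R.
  by rewrite -natrM -natrD ler_nat -mulSnr ltnW// ltn_ceil.
have s2k : n%:R <= 2 * k%:R * s%:R :> R by lra.
have [idx idx_inj rule] := word_representable_order wrF.
have ksn : (k * s <= n)%N by rewrite mulnC leq_trunc_div.
have [W [cW oW]] := interval_blocks idx_inj ksn.
have gF : is_graph F by case: wrF.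
pose Fr : rel 'I_n := fun x y => [set x; y] \in F.
have disjW i j x : (i < k)%N -> (j < k)%N -> x \in W i -> x \in W j -> i = j.
  move=> _ _ xi xj; have [ij|ji|//] := ltngtP i j.
    by have := oW _ _ _ _ ij xi xj; rewrite ltnn.
  by have := oW _ _ _ _ ji xj xi; rewrite ltnn.
have costW : mu * (k%:R ^+ 2 - 3 * k%:R) - 2 * delta * k%:R ^+ 2 - delta <=
    cost R (xorr Fr g) k W.
  apply: core.
  - by move=> x y; rewrite /Fr setUC.
  - move=> a b' c d va vb vc vd ab bc cd dk A B C D; apply: rule.
    + exact: oW A B.
    + exact: oW B C.
    + exact: oW C D.
  - move=> i ik; rewrite cW//.
    have h : eta * n%:R <= eta * (2 * k%:R * s%:R) by rewrite ler_wpM2l// ltW.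
    by rewrite -(ler_pM2l k0); lra.
  - move=> i j A B ik jk _ _ _; rewrite !cW// => cA cB.
    apply: le_trans (disc A B) _.
    have es0 : 0 <= eta * s%:R by rewrite mulr_ge0// ltW.
    have h1 : (eta * s%:R) * (eta * s%:R) <= #|A|%:R * #|B|%:R by apply: ler_pM.
    apply: le_trans (ler_wpM2l (ltW d0) h1).
    rewrite /eps' mulrAC ler_pdivrMr; last by rewrite mulr_gt0 ?exprn_gt0.
    have h2 : n%:R ^+ 2 <= (2 * k%:R * s%:R) ^+ 2 :> R.
      by apply: lerXn2r; rewrite ?nnegrE ?mulr_ge0.
    have de2 : 0 <= delta * eta ^+ 2 by rewrite mulr_ge0 ?sqr_ge0// ltW.
    apply: le_trans (ler_wpM2l de2 h2) _.
    by rewrite le_eqVlt; apply/orP; left; apply/eqP; ring.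
have sumE : \sum_x \sum_(y | y != x) (xorr Fr g x y)%:R = 2 * #|symdiff E F|%:R :> R.
  rewrite -natrM -(handshake (symdiff_graph gE gF)) natr_sum; apply: eq_bigr => x _.
  rewrite natr_sum; apply: eq_bigr => y yx; congr (nat_of_bool _)%:R.
  by rewrite in_symdiff /xorr /Fr EG// eq_sym.
rewrite -sumE; apply: le_trans (block_pairs_le _ _ disjW).
have -> : \sum_(i < k) \sum_(j < k | j != i) ecount R (xorr Fr g) (W i) (W j) =
    s%:R ^+ 2 * cost R (xorr Fr g) k W.
  rewrite /cost mulr_sumr; apply: eq_bigr => i _; rewrite mulr_sumr; apply: eq_bigr => j _.
  rewrite /dens !cW// -expr2; have [s0|s0] := eqVneq s 0%N; last first.
    by rewrite mulrC divfK// expf_neq0// pnatr_eq0.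
  rewrite s0 expr2 !mul0r; apply/eqP; rewrite eq_le ecount_ge0 andbT.
  by apply: le_trans (ecount_le _ _ _ _) _; rewrite !cW// s0 mul0r.
apply: le_trans (ler_wpM2l (sqr_ge0 _) costW).
by apply: block_bound n1 => //; [clear -mu0 mup mu1; lra|exact: ltW].
Qed.

Lemma graph_of_rel n (g : rel 'I_n) : symmetric g -> exists2 E : {set {set 'I_n}}, is_graph E &
  forall x y, x != y -> ([set x; y] \in E) = g x y.
Proof.
move=> gs; exists [set e | [exists x, exists y, [&& x != y, g x y & e == [set x; y]]]].
  apply/forall_inP => e; rewrite inE => /existsP[x /existsP[y /and3P[xy _ /eqP->]]].
  by rewrite cards2 xy.
move=> x y xy; rewrite inE; apply/existsP/idP; last first.
  by move=> gxy; exists x; apply/existsP; exists y; rewrite xy gxy eqxx.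
case=> a /existsP[b /and3P[ab gab /eqP e]].
have : x \in [set a; b] by rewrite -e !inE eqxx.
have : y \in [set a; b] by rewrite -e !inE eqxx orbT.
rewrite !inE => /orP[] /eqP ya /orP[] /eqP xa; subst; rewrite ?eqxx// in xy *.
by rewrite gs.
Qed.

(** The quasirandom graph has only approximately the prescribed number of edges; this makes it exact
    with as few changes as possible. *)
Lemma adjust_edges n (E0 : {set {set 'I_n}}) M : is_graph E0 -> (M <= 'C(n, 2))%N ->
  exists E, [/\ is_graph E, #|E| = M & #|symdiff E0 E|%:R = `|#|E0|%:R - M%:R| :> R].
Proof.
move=> gE0 MC; have gE0' := forall_inP gE0; have [le|lt] := leqP M #|E0|.
  have [E sE cE] := subset_of_card le; exists E; split => //.
    apply/forall_inP => e /(fintype.subsetP sE); exact: gE0'.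
  rewrite ger0_norm ?subr_ge0 ?ler_nat// -natrB// -cE; congr _%:R.
  rewrite /symdiff; have -> : E :\: E0 = set0 by apply/eqP; rewrite setD_eq0.
  by rewrite setU0 cardsD (setIidPr sE).
pose K := [set e : {set 'I_n} | #|e| == 2%N].
have cK : #|K| = 'C(n, 2) by rewrite -[n in 'C(n, 2)]card_ord -card_draws.
have sK : E0 \subset K.
  by apply/fintype.subsetP => e eE; rewrite inE; move/forall_inP: gE0; apply.
have [|A sA cA] := @subset_of_card _ (K :\: E0) (M - #|E0|).
  by rewrite cardsD (setIidPr sK) cK leq_sub2r.
have dA : [disjoint E0 & A].
  rewrite disjoint_sym; apply/pred0P => e /=; apply/negbTE/negP => /andP[/(fintype.subsetP sA)].
  by rewrite inE => /andP[/negbTE ->].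
exists (E0 :|: A); split.
- apply/forall_inP => e; rewrite inE => /orP[|/(fintype.subsetP sA)]; first exact: gE0'.
  by rewrite !inE => /andP[].
- by rewrite cardsU disjoint_setI0// cards0 subn0 cA subnKC// ltnW.
- rewrite ler0_norm ?opprB; last by rewrite subr_le0 ler_nat ltnW.
  rewrite -natrB; last exact: ltnW.
  rewrite -cA; congr _%:R; rewrite /symdiff.
  have -> : E0 :\: (E0 :|: A) = set0 by apply/eqP; rewrite setD_eq0 subsetUl.
  rewrite set0U setDUl setDv set0U; congr #|pred_of_set _|; apply/setDidPl.
  by rewrite disjoint_sym.
Qed.
End Lower.

(** * Averaging over three-colourings *)

Section Mono.
Variables (n : nat).
Implicit Types (E : {set {set 'I_n}}).

Definition monochromatic (col : 'I_n -> 'I_3) (e : {set 'I_n}) : bool :=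
  [forall x in e, forall y in e, col x == col y].

Lemma monochromatic2 col (a b : 'I_n) : monochromatic col [set a; b] = (col a == col b).
Proof.
apply/forall_inP/eqP => [h | h x].
  have := h a; rewrite !inE eqxx => /(_ isT)/forall_inP/(_ b).
  by rewrite !inE eqxx orbT => /(_ isT)/eqP.
rewrite !inE => /orP[] /eqP->; apply/forall_inP => y; rewrite !inE => /orP[] /eqP->;
  by rewrite ?h.
Qed.

Definition shift_at (a : 'I_n) (s : 'I_3) (f : {ffun 'I_n -> 'I_3}) : {ffun 'I_n -> 'I_3} :=
  [ffun z => if z == a then f z + s else f z].

Lemma shift_at_inj a s : injective (shift_at a s).
Proof.
move=> f g /ffunP h; apply/ffunP => z; have := h z; rewrite !ffunE.
by case: ifP => // _ /addIr.
Qed.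

(** With colours in Z/3, split by f b - f a; shifting the colour of a alone maps each class
    bijectively onto the class of difference 0. *)
Lemma card_mono2 (a b : 'I_n) : a != b ->
  (3 * #|[set f : {ffun 'I_n -> 'I_3} | f a == f b]| = #|{: {ffun 'I_n -> 'I_3}}|)%N.
Proof.
move=> ab; rewrite -[RHS]sum1_card (partition_big (fun f : {ffun _} => f b - f a) predT) //=.
rewrite (eq_bigr (fun=> #|[set f : {ffun 'I_n -> 'I_3} | f a == f b]|)).
  by rewrite sum_nat_const card_ord.
move=> s _; rewrite sum1_card -(card_preimset _ (shift_at_inj (a := a) (s := s))).
apply: eq_card => f; rewrite !inE !ffunE eqxx eq_sym [b == a]eq_sym (negbTE ab) unfold_in /=.
by rewrite addrC -subr_eq eq_sym.
Qed.

(** Averaged over all colourings, exactly a third of the edges are monochromatic. *)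
Lemma exists_few_mono E : is_graph E ->
  exists col : 'I_n -> 'I_3, (3 * #|[set e in E | monochromatic col e]| <= #|E|)%N.
Proof.
move=> /forall_inP gE; apply: contrapT => /forallNP h.
have lt (f : {ffun 'I_n -> 'I_3}) : (#|E| < 3 * #|[set e in E | monochromatic f e]|)%N.
  by rewrite ltnNge; apply/negP/h.
have : (\sum_(f : {ffun 'I_n -> 'I_3}) 3 * #|[set e in E | monochromatic f e]| =
        \sum_(f : {ffun 'I_n -> 'I_3}) #|E|)%N.
  rewrite -big_distrr /= sum_nat_const.
  under eq_bigr do rewrite -sum1_card big_mkcond.
  rewrite exchange_big /= -[#|E|]sum1_card big_distrr /= big_distrr /= [RHS]big_mkcond.
  apply: eq_bigr => e _; case: ifP => eE; last first.
    by rewrite big1 ?muln0// => f _; rewrite inE eE.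
  have /cards2P[a [b [ab eab]]] := gE e eE.
  rewrite muln1 -(card_mono2 ab) -sum1_card; congr (3 * _)%N.
  rewrite [RHS]big_mkcond; apply: eq_bigr => f _.
  by rewrite !inE eE eab monochromatic2.
apply/eqP; rewrite gtn_eqF//.
have f0 : {ffun 'I_n -> 'I_3} := [ffun=> ord0].
rewrite (bigD1 f0)//= [X in (_ < X)%N](bigD1 f0)//= -addSn leq_add ?lt//.
by apply: leq_sum => f _; apply: ltnW.
Qed.
End Mono.

(** * Upper bounds on the distance *)

Section Upper.
Variables (R : realType) (n : nat).
Implicit Types (E F : {set {set 'I_n}}).

Definition complete : {set {set 'I_n}} := [set e : {set 'I_n} | #|e| == 2%N].

Lemma complete_wr : word_representable complete.
Proof.
split; first by apply/forall_inP => e; rewrite inE.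
exists (enum 'I_n); split=> [x|x y xy]; first by rewrite mem_enum.
split=> _; last by rewrite inE cards2 xy.
rewrite /alternate; apply: pairwise_sorted; have : uniq [seq z <- enum 'I_n | (z == x) || (z == y)].
  by rewrite filter_uniq ?enum_uniq.
by rewrite uniq_pairwise.
Qed.

Lemma card_complete : #|complete| = 'C(n, 2).
Proof. by rewrite -[n in 'C(n, 2)]card_ord -card_draws. Qed.

Lemma gdist_ge0 E F : 0 <= gdist R E F.
Proof. by rewrite divr_ge0. Qed.

Lemma dist_word_le E F : word_representable F -> dist_word R E <= gdist R E F.
Proof.
move=> wF; apply: ge_inf; last by exists F.
by exists 0 => d [G [_ ->]]; apply: gdist_ge0.
Qed.

Lemma dist_word_ge E (d : R) :
  (forall F, word_representable F -> d <= gdist R E F) -> d <= dist_word R E.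
Proof.
move=> h; apply: lb_le_inf.
  by exists (gdist R E complete), complete; split=> //; exact: complete_wr.
by move=> _ [F [wF ->]]; apply: h.
Qed.

Lemma dist_word_le_third E : is_graph E -> dist_word R E <= #|E|%:R / 'C(n, 2)%:R / 3.
Proof.
move=> gE; have [col few] := exists_few_mono gE.
pose M := [set e in E | monochromatic col e].
have wF : word_representable (E :\: M).
  apply: (@three_colourable_wr n (E :\: M) col).
    apply/forall_inP => e /setDP[eE _]; exact: (forall_inP gE).
  by move=> x y xy; rewrite !inE monochromatic2 negb_and => /andP[/orP[/negP //|//] h]; case: h.
apply: le_trans (dist_word_le E wF) _.
rewrite /gdist mulrAC ler_wpM2r ?invr_ge0// ler_pdivlMr//.
have -> : (E :\: (E :\: M)) :|: ((E :\: M) :\: E) = M.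
  apply/setP => e; rewrite !inE; case: (e \in E); case: (monochromatic _ _) => //=.
by rewrite mulrC -natrM ler_nat.
Qed.

Lemma dist_word_le_compl E : (1 < n)%N -> is_graph E ->
  dist_word R E <= 1 - #|E|%:R / 'C(n, 2)%:R.
Proof.
move=> n1 /forall_inP gE; apply: le_trans (dist_word_le E complete_wr) _.
have C0 : 0 < 'C(n, 2)%:R :> R by rewrite ltr0n bin_gt0.
have sE : E \subset complete by apply/fintype.subsetP => e /gE; rewrite inE.
rewrite /gdist; have -> : E :\: complete = set0 by apply/eqP; rewrite setD_eq0.
rewrite set0U cardsD (setIidPr sE) card_complete natrB; last first.
  by rewrite -card_complete subset_leq_card.
by rewrite mulrBl divff ?gt_eqF.
Qed.
End Upper.

Lemma bin2_natr (R : realType) n : 2 * 'C(n, 2)%:R = n%:R ^+ 2 - n%:R :> R.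
Proof.
have h : (2 * 'C(n, 2) + n = n * n)%N.
  rewrite bin2 mul2n even_halfK; last by case: n => // n; rewrite oddM /= andNb.
  by case: n => // n; rewrite -mulnSr.
by rewrite expr2 -[n%:R * n%:R]natrM -h natrD natrM addrK.
Qed.

(** The discrepancy bound on the whole vertex set shows that the edge count of the quasirandom graph
    is nearly right, so correcting it changes few edges; the triangle inequality transfers the
    distance bound. *)
Lemma far_graph (R : realType) (p eps : R) : 0 <= p -> p <= 1 -> 0 < eps ->
  exists N, forall n, (N <= n)%N -> exists E : {set {set 'I_n}},
    [/\ is_graph E, #|E| = Num.truncn (p * 'C(n, 2)%:R) &
      Num.min (p / 3) (1 - p) - eps <= dist_word R E].
Proof.
move=> p0 p1 e0; set mu := Num.min _ _.
have mup : mu <= p / 3 by rewrite ge_min lexx.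
have mu1 : mu <= 1 - p by rewrite ge_min lexx orbT.
have mu0 : 0 <= mu by rewrite le_min; apply/andP; split; lra.
have e2 : 0 < eps / 2 by rewrite divr_gt0.
have [eps' eps'0 [N1 far]] := quasirandom_far mu0 mup mu1 e2.
pose eta := Num.min eps' (eps / 8).
have eta0 : 0 < eta by rewrite lt_min eps'0; lra.
have eta1 : eta <= eps' by rewrite ge_min lexx.
have eta2 : eta <= eps / 8 by rewrite ge_min lexx orbT.
have [N2 qr] := quasirandom p0 p1 eta0.
exists (N1 + N2 + (Num.truncn (32 / eps)).+2)%N => n nN.
have nN1 : (N1 <= n)%N by apply: leq_trans nN; rewrite -addnA leq_addr.
have nN2 : (N2 <= n)%N by apply: leq_trans nN; rewrite addnAC leq_addl.
have nbig : ((Num.truncn (32 / eps)).+2 <= n)%N by apply: leq_trans nN; rewrite leq_addl.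
have n1 : (1 < n)%N by apply: leq_trans nbig.
have n32 : 32 <= eps * n%:R.
  rewrite mulrC -ler_pdivrMr// ltW//; apply: lt_le_trans (truncnS_gt _) _.
  by rewrite ler_nat ltnW.
have [g gs disc] := qr n nN2.
have [E0 gE0 E0g] := graph_of_rel gs.
have {}far := far n nN1 g gs _ E0 _ gE0 E0g.
set C : R := 'C(n, 2)%:R; have C2 : 2 * C = n%:R ^+ 2 - n%:R := bin2_natr R n.
have C0 : 0 < C by rewrite ltr0n bin_gt0.
have pC0 : 0 <= p * C by rewrite mulr_ge0// ltW.
set M := Num.truncn _.
have /andP[M1 M2] : M%:R <= p * C < M.+1%:R by rewrite truncn_itv.
have MC : (M <= 'C(n, 2))%N.
  by rewrite -(ler_nat R); apply: le_trans M1 _; rewrite ler_piMl// ltW.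
have [E [gE cE dE]] := adjust_edges R gE0 MC.
exists E; split=> //; apply: dist_word_ge => F wF.
have nR : 0 <= n%:R :> R by [].
have hE0 : `|2 * #|E0|%:R - p * n%:R ^+ 2| <= eps / 8 * n%:R ^+ 2 + n%:R.
  have := disc setT setT; rewrite cardsT card_ord -expr2.
  (* The relation [g] may have loops, which add at most n. *)
  have -> : ecount R g setT setT = 2 * #|E0|%:R + \sum_x (g x x)%:R.
    rewrite -natrM -(handshake gE0) natr_sum -big_split /=.
    transitivity (\sum_x \sum_y (g x y)%:R : R).
      by apply: eq_big => [x|x _]; [rewrite inE|apply: eq_bigl => y; rewrite inE].
    apply: eq_bigr => x _.
    rewrite (bigD1 x)//= addrC natr_sum; congr (_ + _).
    by apply: eq_bigr => y yx; rewrite E0g// eq_sym.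
  have d0 : 0 <= \sum_x (g x x)%:R :> R by apply: sumr_ge0.
  have d1 : \sum_x (g x x)%:R <= n%:R :> R.
    rewrite -[X in _ <= X%:R]card_ord -sum1_card natr_sum; apply: ler_sum => x _.
    by case: (g x x).
  have d2 : eta * n%:R ^+ 2 <= eps / 8 * n%:R ^+ 2 by rewrite ler_wpM2r ?sqr_ge0.
  rewrite !ler_norml => /andP[h1 h2]; apply/andP; split; lra.
have hd : 2 * #|symdiff E0 E|%:R <= eps / 8 * n%:R ^+ 2 + 2 * n%:R + 2.
  rewrite dE -ler_pdivlMl//.
  move: M2; rewrite -natr1 => M2.
  have pn : p * n%:R <= n%:R by rewrite ler_piMl.
  have pn0 : 0 <= p * n%:R by rewrite mulr_ge0.
  have hp : p * (2 * C) = p * n%:R ^+ 2 - p * n%:R by rewrite C2 mulrBr.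
  move: hE0; rewrite !ler_norml => /andP[h1 h2]; apply/andP; split; lra.
have n2 : 2 * n%:R + 2 <= eps / 8 * n%:R ^+ 2.
  have : 32 * n%:R <= eps * n%:R * n%:R by rewrite ler_wpM2r.
  have : 1 <= n%:R :> R by rewrite ler1n ltnW.
  rewrite expr2; lra.
have hfar : n%:R ^+ 2 * (mu - eps / 2) <= 2 * #|symdiff E0 F|%:R.
  apply: far => // A B; apply: le_trans (disc A B) _.
  by rewrite ler_wpM2r ?sqr_ge0.
have tri : #|symdiff E0 F|%:R <= #|symdiff E0 E|%:R + #|symdiff E F|%:R :> R.
  by rewrite -natrD ler_nat symdiff_triangle.
rewrite /gdist -/(symdiff E F) ler_pdivlMr// -/C.
(* For mu < eps the bound is negative; otherwise mu - eps >= 0 allows 2 C to be replaced by n ^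
   2. *)
have [me|me] := leP eps mu; last first.
  by apply: le_trans (ler0n _ _); rewrite pmulr_lle0// subr_le0 ltW.
have h : (mu - eps) * (n%:R ^+ 2 - n%:R) <= (mu - eps) * n%:R ^+ 2.
  by rewrite ler_wpM2l ?subr_ge0// gerBl.
have en : 0 <= eps * n%:R ^+ 2 by rewrite mulr_ge0 ?sqr_ge0// ltW.
rewrite -C2 in h; lra.
Qed.

(* Extremal distances and their limits *)
From mathcomp Require Import all_classical all_reals all_analysis.
Local Open Scope classical_set_scope.

Lemma dist_word_upper (R : realType) n (E : {set {set 'I_n}}) : (1 < n)%N -> is_graph E ->
  let d := #|E|%:R / 'C(n, 2)%:R : R in dist_word R E <= Num.min (d / 3) (1 - d).
Proof.
by move=> n1 gE /=; rewrite le_min dist_word_le_third//= dist_word_le_compl.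
Qed.

(** The bounds d / 3 and 1 - d cross at d = 3/4, where both equal 1/4. *)
Lemma dist_word_le_quarter (R : realType) n (E : {set {set 'I_n}}) : (1 < n)%N -> is_graph E ->
  dist_word R E <= 1 / 4.
Proof.
move=> n1 gE; have := dist_word_upper R n1 gE; rewrite /= le_min => /andP[].
set d := _ / 'C(n, 2)%:R; lra.
Qed.

Lemma max_dist_edges_close (R : realType) (p eps : R) : 0 <= p -> p <= 1 -> 0 < eps ->
  exists N, forall n, (N <= n)%N ->
    Num.min (p / 3) (1 - p) - eps <= max_dist_edges R n (Num.truncn (p * 'C(n, 2)%:R))
      <= Num.min (p / 3) (1 - p) + eps.
Proof.
move=> p0 p1 e0; have [N far] := far_graph p0 p1 e0.
exists (N + (Num.truncn (1 / eps)).+2)%N => n nN.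
have [E0 [gE0 cE0 dE0]] := far n (leq_trans (leq_addr _ _) nN).
have nbig : ((Num.truncn (1 / eps)).+2 <= n)%N by apply: leq_trans nN; rewrite leq_addl.
have n1 : (1 < n)%N by apply: leq_trans nbig.
set C : R := 'C(n, 2)%:R; have C0 : 0 < C by rewrite ltr0n bin_gt0.
(* Rounding the edge count down then changes the density by at most eps. With t >= 1 / eps and n >=
   t + 1, 2 C >= t (t + 1) >= 2 t. *)
have eC : 1 <= eps * C.
  rewrite mulrC -ler_pdivrMr// ltW//; apply: lt_le_trans (truncnS_gt _) _.
  rewrite ler_nat -(leq_pmul2l (isT : (0 < 2)%N)) -(ler_nat R) !natrM bin2_natr -natrM.
  have : (1 + (Num.truncn (1 / eps)).+1 <= n)%N by rewrite add1n.
  rewrite -(ler_nat R) natrD; set t : R := (Num.truncn _).+1%:R => tn.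
  have t1 : 1 <= t by rewrite ler1n.
  have : (1 + t) * n%:R <= n%:R * n%:R by rewrite ler_wpM2r.
  have : t * (1 + t) <= t * n%:R by rewrite ler_wpM2l//; lra.
  have : t <= t * t by rewrite ler_peMl//; lra.
  rewrite expr2; lra.
have pC0 : 0 <= p * C by rewrite mulr_ge0// ltW.
set M := Num.truncn _ in cE0 *.
have /andP[M1 M2] : M%:R <= p * C < M.+1%:R by rewrite truncn_itv.
have ub : ubound [set d : R | exists E : {set {set 'I_n}},
    [/\ is_graph E, #|E| = M & d = dist_word R E]] (Num.min (p / 3) (1 - p) + eps).
  move=> _ [E [gE cE ->]]; have := dist_word_upper R n1 gE; rewrite /= cE -/C.
  have q1 : M%:R / C <= p by rewrite ler_pdivrMr.
  have q2 : p <= M%:R / C + eps.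
    by rewrite -lerBlDr ler_pdivlMr// mulrBl; move: M2; rewrite -natr1; lra.
  rewrite le_min => /andP[h1 h2]; rewrite -lerBlDr le_min; apply/andP; split; lra.
apply/andP; split.
  by apply: le_trans dE0 _; apply: ub_le_sup; [exists (Num.min (p / 3) (1 - p) + eps)|exists E0].
by apply: ge_sup => //; exists (dist_word R E0), E0.
Qed.

Theorem mainTheorem1 (R : realType) :
  [/\ (forall p : R, 0 <= p <= 1 ->
         max_dist_edges R n (Num.truncn (p * ('C(n, 2))%:R)) @[n --> \oo]
           --> (Order.min (p / 3) (1 - p) : R^o)),
      max_dist R n @[n --> \oo] --> (1 / 4 : R^o)
    & forall (eps : R), 0 < eps -> forall (n : nat), (2 <= n)%N ->
        forall E : {set {set 'I_n}}, is_graph E ->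
          1 / 4 - eps <= dist_word R E ->
          3 / 4 - 3 * eps <= (#|E|)%:R / ('C(n, 2))%:R <= 3 / 4 + eps].
Proof.
split.
- move=> p /andP[p0 p1]; apply/cvgrPdist_le => eps e0.
  have [N h] := max_dist_edges_close p0 p1 e0.
  exists N => // n /= nN; have /andP[h1 h2] := h n nN.
  by rewrite ler_norml; apply/andP; split; lra.
- apply/cvgrPdist_le => eps e0.
  have [||N far] := @far_graph R (3 / 4) eps _ _ e0; [lra|lra|].
  exists (N + 2)%N => // n /= nN.
  have n1 : (1 < n)%N by apply: leq_trans nN; rewrite leq_addl.
  have [E0 [gE0 _ dE0]] := far n (leq_trans (leq_addr _ _) nN).
  have {}dE0 : 1 / 4 - eps <= dist_word R E0.
    by apply: le_trans dE0; rewrite lerD2r le_min; apply/andP; split; lra.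
  have ub : ubound [set d : R | exists E : {set {set 'I_n}}, is_graph E /\ d = dist_word R E] (1 / 4).
    by move=> _ [E [gE ->]]; apply: dist_word_le_quarter.
  have h1 : 1 / 4 - eps <= max_dist R n.
    by apply: le_trans dE0 _; apply: ub_le_sup; [exists (1 / 4)|exists E0].
  have h2 : max_dist R n <= 1 / 4 by apply: ge_sup => //; exists (dist_word R E0), E0.
  by rewrite ler_norml; apply/andP; split; lra.
- move=> eps e0 n n1 E gE far; have := dist_word_upper R n1 gE; rewrite /= le_min => /andP[].
  (* The bound d / 3 gives the lower end of the interval and 1 - d the upper end. *)
  set d := _ / 'C(n, 2)%:R => h1 h2; apply/andP; split; lra.
Qed.
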